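(* For $\alpha\in(0,2)$, $\rho\in(-1,\alpha)$, $r\in(0,\infty)$, $k\in K_\alpha$, and all $u\in L^2(\mathbb{R},|x|^{-\alpha}dx)$, $$\mathcal{E}_k[u]=\int_{\mathbb{R}}u^2(x)\,m_{k,r,\rho}(x)\,dx+\frac12\int_{\mathbb{R}}\int_{\mathbb{R}}\left(\frac{u(x)}{h_{\rho,r}(x)}-\frac{u(y)}{h_{\rho,r}(y)}\right)^2h_{\rho,r}(x)h_{\rho,r}(y)k(x,y)\,dx\,dy .$$
   Context: All functions are Borel measurable, $u$ is real-valued. For $\alpha\in(0,2)$, $K_\alpha$ is the set of all functions $k:\mathbb{R}^2\to[0,\infty]$ such that $k(x,y)=k(y,x)$ for all $x,y\in\mathbb{R}$; $k(tx,ty)=t^{-\alpha-1}k(x,y)$ for all $x,y\in\mathbb{R}$, $t>0$; and there is a constant $c\in(0,\infty)$ with $k(x,y)\le c|x-y|^{-\alpha-1}$ for all $x,y$. Put $$\mathcal{E}_k[u]:=\frac12\int_{\mathbb{R}}\int_{\mathbb{R}}(u(x)-u(y))^2k(x,y)\,dy\,dx\in[0,\infty].$$ Define $$\gamma_+(k,\rho):=\int_0^1(1-t^\rho)(1-t^{\alpha-1-\rho})k(1,t)\,dt,\qquad \gamma_-(k,\rho):=\int_0^1(1-t^\rho)(1-t^{\alpha-1-\rho})k(-1,-t)\,dt,$$ $$C_+(k,r,\rho):=\gamma_+(k,\rho)+\int_0^\infty k(1,-t)\,dt-r\int_0^\infty t^\rho k(1,-t)\,dt,$$ $$C_-(k,r,\rho):=\gamma_-(k,\rho)+\int_0^\infty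 k(-1,t)\,dt-\frac1r\int_0^\infty t^\rho k(-1,t)\,dt .$$ Then $m_{k,r,\rho}(x):=|x|^{-\alpha}C_+(k,r,\rho)$ for $x>0$, $m_{k,r,\rho}(x):=|x|^{-\alpha}C_-(k,r,\rho)$ for $x<0$; and $h_{\rho,r}(x):=|x|^\rho$ for $x>0$, $h_{\rho,r}(x):=r|x|^\rho$ for $x<0$. (The point $x=0$ is irrelevant.) *)

(* Defs.v *)
From mathcomp Require Import all_boot all_order all_algebra.
From mathcomp Require Import all_classical all_reals all_analysis.
From mathcomp Require Import measurable_realfun.

Set Implicit Arguments.
Unset Strict Implicit.
Unset Printing Implicit Defensive.

Import Order.TTheory GRing.Theory Num.Theory.
Import numFieldNormedType.Exports.

Local Open Scope classical_set_scope.
Local Open Scope ring_scope.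
Local Open Scope ereal_scope.

Section GroundState.
Variable R : realType.
Local Notation mu := (@lebesgue_measure R).

Implicit Types (alpha rho r : R) (k : R -> R -> \bar R) (u : R -> R).

(* The upper bound is only required off the diagonal: on the diagonal
   |x - y|^(-alpha-1) stands for +oo, whereas 0 `^ (- alpha - 1) = 0. *)
Definition homogeneous_kernels alpha : set (R -> R -> \bar R) :=
  [set k : R -> R -> \bar R |
            [/\ measurable_fun [set: R * R] (fun z : R * R => k z.1 z.2),
               forall x y, 0 <= k x y,
               forall x y, k x y = k y x,
               forall x y t, (0 < t)%R ->
                 k (t * x)%R (t * y)%R = (t `^ (- alpha - 1))%:E * k x y
             & exists2 c : R, (0 < c)%R &
                 forall x y, x != y ->
                   k x y <= (c * `|x - y| `^ (- alpha - 1))%:E]].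

Definition energy k u : \bar R :=
  2^-1%:E *
  \int[mu]_x \int[mu]_y (((u x - u y) ^+ 2)%:E * k x y).

Definition gamma_plus alpha k rho : \bar R :=
  \int[mu]_(t in `]0%R, 1%R[)
     (((1 - t `^ rho) * (1 - t `^ (alpha - 1 - rho)))%:E * k 1%R t).

Definition gamma_minus alpha k rho : \bar R :=
  \int[mu]_(t in `]0%R, 1%R[)
     (((1 - t `^ rho) * (1 - t `^ (alpha - 1 - rho)))%:E
        * k (-1)%R (- t)%R).

(* For kernels in homogeneous_kernels alpha, 0 < alpha < 2 and
   -1 < rho < alpha, all the terms below are finite. *)
Definition C_plus alpha k r rho : \bar R :=
  gamma_plus alpha k rho
  + \int[mu]_(t in `]0%R, +oo[) k 1%R (- t)%R
  - r%:E * \int[mu]_(t in `]0%R, +oo[) ((t `^ rho)%:E * k 1%R (- t)%R).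

Definition C_minus alpha k r rho : \bar R :=
  gamma_minus alpha k rho
  + \int[mu]_(t in `]0%R, +oo[) k (-1)%R t
  - r^-1%:E * \int[mu]_(t in `]0%R, +oo[) ((t `^ rho)%:E * k (-1)%R t).

(* The values at 0 of hardy_potential and ground_state are arbitrary. *)
Definition hardy_potential alpha k r rho (x : R) : \bar R :=
  if (0 < x)%R then (`|x| `^ (- alpha))%:E * C_plus alpha k r rho
  else if (x < 0)%R then (`|x| `^ (- alpha))%:E * C_minus alpha k r rho
  else 0.

Definition ground_state rho r (x : R) : R :=
  (if 0 < x then `|x| `^ rho else if x < 0 then r * `|x| `^ rho else 0)%R.

(* Members are everywhere-defined representatives, not classes modulo a.e. equality. *)
Definition weighted_L2 alpha : set (R -> R) :=
  [set u : R -> R | measurable_fun [set: R] u /\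
           \int[mu]_x (u x ^+ 2 * `|x| `^ (- alpha))%:E < +oo].

End GroundState.

(* Main.v *)
(* Both double integrals have a symmetric integrand, so each is a sum over the
   pairs 0 < y < x, the pairs x < y < 0 and the pairs of opposite signs.  With
   h the ground state, the pointwise identity behind the theorem is
     (a - b)^2 + a^2 h(y)/h(x) + b^2 h(x)/h(y)
       = (a/h(x) - b/h(y))^2 h(x) h(y) + a^2 + b^2,
   where a = u(x) and b = u(y).  For opposite signs all the square terms are
   integrable and the identity can be integrated directly.  For equal signs they
   are not, since k is singular on the diagonal.  There one substitutes y = t x
   with 0 < t < 1 and first integrates in x against |x|^-alpha with t fixed:
   by scaling, the square terms contribute (1 - t^rho)(1 - t^(alpha-1-rho)) times
   the weighted norm, and this is integrable against k(1, t) because alpha < 2.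
   In this order of integration no principal value or limit is needed. *)
Require Import Defs.
From mathcomp Require Import all_boot all_order all_algebra.
From mathcomp Require Import all_classical all_reals all_analysis.
From mathcomp Require Import measurable_realfun.
From mathcomp Require Import ring lra.

Import Order.TTheory GRing.Theory Num.Theory.
Import numFieldNormedType.Exports.

Local Open Scope classical_set_scope.
Local Open Scope ring_scope.
Local Open Scope ereal_scope.

(** * Scaling and Tonelli's theorem on the half-line *)

(** Either side of the theorem may be [+oo], and then differences lose their meaning. Every
    pointwise identity is therefore integrated in additive form, with nonnegative terms on both
    sides, and only terms already known to be finite are cancelled afterwards. The finite terms are
    products of a weighted norm of [u] on a half-line with a one-dimensional integral of [k]. The
    bound on [k] becomes a multiple of (1 - t)^(-alpha-1) for equal signs and of (1 + t)^(-alpha-1)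
    for opposite signs. Near t = 0 the weights produce the powers 0, rho, alpha-1-rho and alpha-1,
    which all exceed -1 when 0 < alpha and -1 < rho < alpha; at infinity t^rho (1 + t)^(-alpha-1) is
    integrable because rho < alpha. The negative half-line is reduced to the positive one by
    reflecting [u] and [k]; the reflected kernels are homogeneous of the same degree. *)

Section half_line_integrals.
Context {R : realType}.
Local Notation mu := (@lebesgue_measure R).
Local Notation pos := (`]0%R, +oo[%classic : set R).
Implicit Types (F : R -> R -> \bar R) (f : R -> \bar R).

(** Lebesgue measure is [s] times its push-forward under x -> s x: both agree on half-open
    intervals, and uniqueness does the rest. Arguing with measures makes the substitution available
    for integrands that are merely measurable. *)
Lemma ge0_integralZ_var (s : R) (D : set R) f : (0 < s)%R -> measurable D ->
  measurable_fun D f -> (forall x, D x -> 0 <= f x) ->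
  \int[mu]_(x in D) f x =
  s%:E * \int[mu]_(x in (fun x : R => (s * x)%R) @^-1` D) f (s * x)%R.
Proof.
move=> s0 mD mf f0.
pose phi : measurableTypeR R -> measurableTypeR R := fun x => (s * x)%R.
have ms : measurable_fun setT phi by exact: mulrl_measurable.
pose push_of : {measure set (measurableTypeR R) -> \bar R} := pushforward mu phi.
pose push := push_of ms.
pose s' : {nonneg R} := NngNum (ltW s0).
have muE A : measurable A -> mu A = mscale s' push A.
  apply: lebesgue_measure_unique => _ [[a b]] _ <-.
  rewrite -[RHS]/(s%:E * mu ((fun x : R => (s * x)%R) @^-1` `]a, b]%classic)).
  rewrite (_ : _ @^-1` _ = `](a / s)%R, (b / s)%R]%classic); last first.
    by apply/seteqP; split=> x /=; rewrite !in_itv/= ltr_pdivrMr// ler_pdivlMr// mulrC.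
  rewrite !lebesgue_measure_itv/= !lte_fin ltr_pM2r ?invr_gt0//.
  case: ifPn => _; last by rewrite mule0.
  by rewrite -!EFinB -EFinM -mulrBl mulrC divfK// gt_eqF.
rewrite (_ : s%:E = (s'%:num)%:E)//.
rewrite -[X in _ * X](@ge0_integral_pushforward _ _ _ _ R _ ms mu D f)//; last first.
  by move=> y /[!inE] /f0.
rewrite -[X in _ * X]/(\int[push]_(x in D) f x).
rewrite -ge0_integral_mscale//.
by apply: eq_measure_integral => A mA _; exact: muE.
Qed.

Lemma ge0_integral_posZ (s : R) f : (0 < s)%R ->
  measurable_fun setT f -> (forall x, 0 <= f x) ->
  \int[mu]_(x in pos) f x = s%:E * \int[mu]_(x in pos) f (s * x)%R.
Proof.
move=> s0 mf f0; rewrite (@ge0_integralZ_var s)//; last exact: measurable_funTS.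
congr (_ * \int[_]_(x in _) _).
by apply/seteqP; split=> x /=; rewrite !in_itv/= !andbT pmulr_rgt0.
Qed.

Lemma ge0_integral_itv0Z (s : R) f : (0 < s)%R ->
  measurable_fun setT f -> (forall x, 0 <= f x) ->
  \int[mu]_(x in `]0%R, s[) f x = s%:E * \int[mu]_(x in `]0%R, 1%R[) f (s * x)%R.
Proof.
move=> s0 mf f0; rewrite (@ge0_integralZ_var s)//; last exact: measurable_funTS.
congr (_ * \int[_]_(x in _) _).
by apply/seteqP; split=> x /=; rewrite !in_itv/= pmulr_rgt0// gtr_pMr.
Qed.

Lemma integral_posN f : measurable_fun setT f -> (forall x, 0 <= f x) ->
  \int[mu]_(x in `]-oo, 0%R[) f x = \int[mu]_(x in pos) f (- x)%R.
Proof.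
move=> mf f0.
have mfN : measurable_fun [set: R] (fun x => f (- x)%R).
  by apply: (@measurableT_comp _ _ _ _ _ _ f) => //; exact: oppr_measurable.
rewrite integral_itv_obnd_cbnd; last exact: measurable_funTS.
rewrite ge0_integration_by_substitution0//.
rewrite -integral_itv_bndo_bndc; last first.
  apply: measurable_funTS; under eq_fun do rewrite opprK; exact: mf.
by apply: eq_integral => x _; rewrite opprK.
Qed.

(** Stated for signed [f], since it also splits the integral of the Hardy potential, whose constants
    may be negative. *)
Lemma integral_pos_neg f : measurable_fun setT f ->
  \int[mu]_x f x = \int[mu]_(x in pos) f x + \int[mu]_(x in `]-oo, 0%R[) f x.
Proof.
move=> mf.
have -> : [set: R] = `[0%R, +oo[%classic `|` `]-oo, 0%R[%classic.
  apply/seteqP; split=> x //= _; rewrite !in_itv/= andbT.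
  by case: (leP 0%R x) => h; [left|right].
rewrite integral_setU//.
- by rewrite integral_itv_obnd_cbnd//; exact: measurable_funTS.
- exact: measurable_funTS.
- apply/disj_set2P/seteqP; split=> x //= []; rewrite !in_itv/= andbT.
  by rewrite leNgt => /negbTE ->.
Qed.

Lemma ge0_integral_pos_opp f : measurable_fun setT f -> (forall x, 0 <= f x) ->
  \int[mu]_x f x = \int[mu]_(x in pos) f x + \int[mu]_(x in pos) f (- x)%R.
Proof. by move=> mf f0; rewrite integral_pos_neg// integral_posN. Qed.

Definition jointly_measurable F :=
  measurable_fun [set: R * R] (fun z : R * R => F z.1 z.2).

Lemma jointly_measurable_comp d (T : measurableType d) F (p q : T -> R) :
  jointly_measurable F -> measurable_fun setT p -> measurable_fun setT q ->
  measurable_fun setT (fun z => F (p z) (q z)).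
Proof.
move=> mF mp mq.
by apply: (measurableT_comp mF (g := fun z => (p z, q z))); exact: measurable_fun_pair.
Qed.

Lemma jointly_measurable_swap F :
  jointly_measurable F -> jointly_measurable (fun x y => F y x).
Proof. by move=> mF; exact: (jointly_measurable_comp _ _ _ snd fst). Qed.

Lemma jointly_measurable1 F x : jointly_measurable F -> measurable_fun setT (F x).
Proof. by move=> mF; exact: (jointly_measurable_comp _ _ _ (cst x) id). Qed.

(** Extending [F] by zero off [A] turns an integral over a moving section into one over the whole
    line, to which Tonelli's theorem applies. The next lemma uses the same extension. *)
Lemma jointly_measurable_int (A : set (R * R)) F : measurable A ->
  jointly_measurable F -> (forall z, A z -> 0 <= F z.1 z.2) ->
  measurable_fun setT (fun x => \int[mu]_(y in xsection A x) F x y).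
Proof.
move=> mA mF F0.
pose G := (fun z : R * R => F z.1 z.2) \_ A.
have mG : measurable_fun setT G 
  by apply: (measurable_restrictT _ mA).1; apply: measurable_funTS; exact: mF.
have G0 z : 0 <= G z by apply: erestrict_ge0 ; exact: F0.
have := @measurable_fun_fubini_tonelli_F _ _ _ _ R mu G mG G0.
congr (measurable_fun _ _); apply/funext => x.
rewrite /fubini_F [RHS]integral_mkcond; apply: eq_integral => y _.
by rewrite /G /patch mem_xsection.
Qed.

Lemma tonelli_section (A : set (R * R)) F : measurable A ->
  jointly_measurable F -> (forall z, A z -> 0 <= F z.1 z.2) ->
  \int[mu]_x \int[mu]_(y in xsection A x) F x y =
  \int[mu]_y \int[mu]_(x in ysection A y) F x y.
Proof.
move=> mA mF F0.
pose G := (fun z : R * R => F z.1 z.2) \_ A.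
have mG : measurable_fun setT G 
  by apply: (measurable_restrictT _ mA).1; apply: measurable_funTS; exact: mF.
have G0 z : 0 <= G z by apply: erestrict_ge0 ; exact: F0.
have := @fubini_tonelli _ _ _ _ R mu mu G mG G0.
congr (_ = _); apply: eq_integral => x _; rewrite [RHS]integral_mkcond;
  by apply: eq_integral => y _; rewrite /G /patch ?mem_xsection ?mem_ysection.
Qed.

Lemma measurable_int_in (E : set R) F : measurable E ->
  jointly_measurable F -> (forall x y, E y -> 0 <= F x y) ->
  measurable_fun setT (fun x => \int[mu]_(y in E) F x y).
Proof.
move=> mE mF F0.
have := @jointly_measurable_int (setT `*` E) F (measurableX measurableT mE) mF.
move=> /(_ (fun z zE => F0 z.1 z.2 zE.2)).
by under eq_fun do rewrite in_xsectionX ?inE//.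
Qed.

(** Nonnegativity is asked on the rectangle only, because polar integrands carry the Jacobian factor
    [x], which is negative on the left half-line. *)
Lemma tonelli_in (D E : set R) F : measurable D -> measurable E ->
  jointly_measurable F -> (forall x y, D x -> E y -> 0 <= F x y) ->
  \int[mu]_(x in D) \int[mu]_(y in E) F x y =
  \int[mu]_(y in E) \int[mu]_(x in D) F x y.
Proof.
move=> mD mE mF F0.
have := tonelli_section _ _ (measurableX mD mE) mF (fun z zDE => F0 z.1 z.2 zDE.1 zDE.2).
rewrite [in X in X -> _](_ : \int[mu]_x _ = \int[mu]_(x in D) \int[mu]_(y in E) F x y); last first.
  rewrite [RHS]integral_mkcond; apply: eq_integral => x _; rewrite patchE.
  case: ifPn => xD; first by rewrite in_xsectionX.
  by rewrite notin_xsectionX// integral_set0.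
move=> ->; rewrite [RHS]integral_mkcond; apply: eq_integral => y _; rewrite patchE.
case: ifPn => yE; first by rewrite in_ysectionX.
by rewrite notin_ysectionX// integral_set0.
Qed.

End half_line_integrals.

(** * Quadrants, triangles and the substitution y = x t *)

Section plane_integrals.
Context {R : realType}.
Local Notation mu := (@lebesgue_measure R).
Local Notation pos := (`]0%R, +oo[%classic : set R).
Implicit Types (F : R -> R -> \bar R) (f : R -> \bar R).

(** Tonelli and the symmetry of [F] identify the two quadrants of mixed signs, hence the repeated
    summand. The repetition is later absorbed by the factor 1/2. *)
Lemma integral_quadrants F : jointly_measurable F -> (forall x y, 0 <= F x y) ->
  (forall x y, F x y = F y x) ->
  \int[mu]_x \int[mu]_y F x y =
  (\int[mu]_(x in pos) \int[mu]_(y in pos) F x y +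
   \int[mu]_(x in pos) \int[mu]_(y in pos) F (- x)%R (- y)%R) +
  (\int[mu]_(x in pos) \int[mu]_(y in pos) F x (- y)%R +
   \int[mu]_(x in pos) \int[mu]_(y in pos) F x (- y)%R).
Proof.
move=> mF F0 Fsym.
have mN (p : R * R -> R) : measurable_fun setT p -> measurable_fun setT (fun z => (- p z)%R).
  by move=> mp; exact: measurable_funN.
have mFN : jointly_measurable (fun x y => F x (- y)%R).
  by apply: (jointly_measurable_comp _ _ F fst (fun z : R * R => - z.2)%R) => //; exact: mN.
have mNF : jointly_measurable (fun x y => F (- x)%R y).
  by apply: (jointly_measurable_comp _ _ F (fun z : R * R => - z.1)%R snd) => //; exact: mN.
have mNN : jointly_measurable (fun x y => F (- x)%R (- y)%R).
  by apply: (jointly_measurable_comp _ _ F (fun z : R * R => - z.1)%R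
    (fun z : R * R => - z.2)%R) => //; exact: mN.
have inner x : \int[mu]_y F x y =
    \int[mu]_(y in pos) F x y + \int[mu]_(y in pos) F x (- y)%R.
  by apply: ge0_integral_pos_opp => //; exact: jointly_measurable1.
under eq_integral do rewrite inner.
have mI G : jointly_measurable G -> (forall x y, 0 <= G x y) ->
    measurable_fun setT (fun x => \int[mu]_(y in pos) G x y).
  by move=> mG G0; apply: measurable_int_in.
have I0 (G : R -> \bar R) : (forall x, 0 <= G x) -> 0 <= \int[mu]_(y in pos) G y.
  by move=> G0; apply: integral_ge0.
rewrite ge0_integralD//; [|by move=> x _; exact: I0|exact: mI|by move=> x _; exact: I0|exact: mI].
rewrite !ge0_integral_pos_opp; [|exact: mI|by move=> x; exact: I0|exact: mI|by move=> x; exact: I0].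
have -> : \int[mu]_(x in pos) \int[mu]_(y in pos) F (- x)%R y =
    \int[mu]_(x in pos) \int[mu]_(y in pos) F x (- y)%R.
  rewrite tonelli_in//; apply: eq_integral => x _; apply: eq_integral => y _.
  by rewrite Fsym.
by rewrite [in X in _ + X = _]addeC addeACA.
Qed.

(** The diagonal is null, and Tonelli with symmetry carries the triangle y > x onto the triangle y <
    x. The triangles [A] and [B] are encoded as subsets of the plane so that their sections are the
    moving inner domains. *)
Lemma integral_triangle F : jointly_measurable F -> (forall x y, 0 <= F x y) ->
  (forall x y, F x y = F y x) ->
  \int[mu]_(x in pos) \int[mu]_(y in pos) F x y =
  \int[mu]_(x in pos) \int[mu]_(y in `]0%R, x[) F x y +
  \int[mu]_(x in pos) \int[mu]_(y in `]0%R, x[) F x y.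
Proof.
move=> mF F0 Fsym.
have mFx x : measurable_fun setT (F x) by exact: jointly_measurable1.
pose A : set (R * R) := [set z | 0 < z.2 < z.1]%R.
pose B : set (R * R) := [set z | 0 < z.1 < z.2]%R.
have mlt (p q : R * R -> R) : measurable_fun setT p -> measurable_fun setT q ->
    measurable [set z | p z < q z]%R.
  by move=> mp mq; rewrite -[X in measurable X]setTI; have := measurable_fun_ltr mp mq; apply.
have mA : measurable A.
  rewrite (_ : A = [set z | 0 < z.2]%R `&` [set z | z.2 < z.1]%R); last first.
    by apply/seteqP; split=> z /andP.
  by apply: measurableI; apply: mlt.
have mB : measurable B.
  rewrite (_ : B = [set z | 0 < z.1]%R `&` [set z | z.1 < z.2]%R); last first.
    by apply/seteqP; split=> z /andP.
  by apply: measurableI; apply: mlt.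
have secA x : xsection A x = `]0%R, x[%classic.
  by apply/seteqP; split=> y; rewrite /xsection/= inE /A/= in_itv.
have secB x : (0 < x)%R -> xsection B x = `]x, +oo[%classic.
  by move=> x0; apply/seteqP; split=> y; rewrite /xsection/= inE /B/= in_itv/= andbT x0.
have ysecB x : ysection B x = `]0%R, x[%classic.
  by apply/seteqP; split=> y; rewrite /ysection/= inE /B/= in_itv.
(* Tonelli on sections integrates over the whole line; the sections over x <= 0 are empty, so the
   outer domain may shrink to [pos]. *)
have sec0 (G : R -> set R) : (forall x, x \notin pos -> G x = set0) ->
    \int[mu]_x \int[mu]_(y in G x) F x y = \int[mu]_(x in pos) \int[mu]_(y in G x) F x y.
  move=> G0; rewrite [RHS]integral_mkcond; apply: eq_integral => x _.
  by rewrite patchE; case: ifPn => // /G0 ->; rewrite integral_set0.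
have -> : \int[mu]_(x in pos) \int[mu]_(y in pos) F x y =
    \int[mu]_(x in pos) (\int[mu]_(y in xsection A x) F x y + \int[mu]_(y in xsection B x) F x y).
  apply: eq_integral => x; rewrite inE/= in_itv/= andbT => x0.
  have -> : pos = `]0%R, x[%classic `|` `[x, +oo[%classic.
    apply/seteqP; split=> y /=; rewrite !in_itv/= !andbT.
      by move=> y0; case: (ltP y x) => h; [left; rewrite y0|right].
    by case=> [/andP[]//|]; exact: lt_le_trans.
  rewrite ge0_integral_setU//; last 2 first.
  - exact: measurable_funTS (mFx x).
  - apply/disj_set2P/seteqP; split=> y //= []; rewrite !in_itv/= andbT => /andP[_].
    by rewrite ltNge => /negbTE ->.
  rewrite secA secB//; congr (_ + _).
  by rewrite integral_itv_obnd_cbnd//; exact: measurable_funTS (mFx x).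
have mint D : measurable D -> measurable_fun pos (fun x => \int[mu]_(y in xsection D x) F x y).
  by move=> mD; apply: measurable_funTS; apply: jointly_measurable_int => // z _; exact: F0.
rewrite ge0_integralD; [|exact: measurable_itv|by move=> x _; apply: integral_ge0
  |exact: mint|by move=> x _; apply: integral_ge0|exact: mint].
have e0 x : x \notin pos -> `]0%R, x[%classic = set0 :> set R.
  move=> /negP xp; apply/seteqP; split=> y //=; rewrite in_itv/= => /andP[y0 yx].
  by apply: xp; rewrite inE/= in_itv/= andbT (lt_trans y0).
apply: congr2; first by apply: eq_integral => x _; rewrite secA.
rewrite -[LHS](sec0 (xsection B)); last first.
  move=> x /negP xp; apply/seteqP; split=> y //=; rewrite /xsection/= inE /B/= => /andP[x0 xy].
  by apply: xp; rewrite inE/= in_itv/= andbT.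
rewrite tonelli_section//.
rewrite -[RHS](sec0 (fun x => `]0%R, x[%classic))//.
apply: eq_integral => x _; rewrite ysecB; apply: eq_integral => y _; exact: Fsym.
Qed.

(** The substitution y = x t has Jacobian [x]. Tonelli then moves the ratio [t] outside, so that the
    singularity at t = 1 is met only after the integration in [x]. *)
Lemma integral_triangle_polar F : jointly_measurable F -> (forall x y, 0 <= F x y) ->
  \int[mu]_(x in pos) \int[mu]_(y in `]0%R, x[) F x y =
  \int[mu]_(t in `]0%R, 1%R[) \int[mu]_(x in pos) (x%:E * F x (x * t)%R).
Proof.
move=> mF F0.
have mx : measurable_fun setT (fun z : R * R => z.1%:E).
  by apply/measurable_EFinP; exact: measurable_fst.
have mxt : measurable_fun setT (fun z : R * R => z.1 * z.2)%R.
  exact: measurable_funM.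
have mG : jointly_measurable (fun x t => x%:E * F x (x * t)%R).
  apply: emeasurable_funM => //.
  exact: (jointly_measurable_comp _ _ F fst (fun z : R * R => z.1 * z.2)%R).
rewrite -tonelli_in//; last first.
  move=> x t /=; rewrite in_itv/= andbT => x0 _.
  by rewrite mule_ge0// lee_fin ltW.
apply: eq_integral => x; rewrite inE/= in_itv/= andbT => x0.
have mFx : measurable_fun setT (F x) by exact: jointly_measurable1.
rewrite ge0_integral_itv0Z// ge0_integralZl//.
- apply: measurable_funTS; apply: (measurableT_comp mFx).
  exact: mulrl_measurable.
- by rewrite lee_fin ltW.
Qed.

Lemma integral_quadrant_polar F : jointly_measurable F -> (forall x y, 0 <= F x y) ->
  \int[mu]_(x in pos) \int[mu]_(y in pos) F x y =
  \int[mu]_(x in pos) \int[mu]_(t in pos) (x%:E * F x (x * t)%R).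
Proof.
move=> mF F0; apply: eq_integral => x; rewrite inE/= in_itv/= andbT => x0.
have mFx : measurable_fun setT (F x) by exact: jointly_measurable1.
rewrite (ge0_integral_posZ x)// ge0_integralZl//.
- apply: measurable_funTS; apply: (measurableT_comp mFx).
  exact: mulrl_measurable.
- by rewrite lee_fin ltW.
Qed.

End plane_integrals.

(** * Integrals of powers *)

Section power_integrals.
Context {R : realType}.
Local Notation mu := (@lebesgue_measure R).

(** The fundamental theorem of calculus bounds the integral over each compact interval by G(b n) -
    G(a n), and monotone convergence passes to the union. The crude bound M + M suffices, as only
    finiteness is wanted. *)
Lemma integral_derivative_bounded (a b : nat -> R) (G g : R -> R) (M : R) :
  {homo a : m n / (m <= n)%N >-> (n <= m)%R} ->
  {homo b : m n / (m <= n)%N >-> (m <= n)%R} -> (forall n, a n < b n)%R ->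
  let D := \bigcup_n `[a n, b n]%classic in
  (forall x, D x -> is_derive x 1%R G (g x)) ->
  (forall x, D x -> {for x, continuous g}) ->
  (forall x, D x -> 0 <= g x)%R -> (forall x, D x -> `|G x| <= M)%R ->
  \int[mu]_(x in D) (g x)%:E <= (M + M)%:E.
Proof.
move=> da db ab D dG cg g0 GM.
have sD n : `[a n, b n]%classic `<=` D by move=> x xab; exists n.
have cgn n : {within `[a n, b n], continuous g}.
  apply: continuous_in_subspaceT => x; rewrite inE => xab.
  by apply: cg; exact: sD xab.
have nd : {homo (fun n => `[a n, b n]%classic) : m n / (m <= n)%N >-> (m <= n)%O}.
  move=> m n mn; apply/subsetPset; apply: subset_itv; rewrite bnd_simp; [exact: da|exact: db].
have cv : \int[mu]_(x in `[a n, b n]) (g x)%:E @[n --> \oo] --> \int[mu]_(x in D) (g x)%:E.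
  apply: ge0_nondecreasing_set_cvg_integral => // [n|n x xab].
  - by apply/measurable_EFinP; apply: subspace_continuous_measurable_fun => //; exact: cgn.
  - by rewrite lee_fin g0//; exact: sD xab.
rewrite -(cvg_lim _ cv)//; apply: lime_le; first by apply/cvg_ex; eexists; exact: cv.
apply: nearW => n.
have an : D (a n) by apply: (sD n); rewrite /= in_itv/= lexx ltW.
have bn : D (b n) by apply: (sD n); rewrite /= in_itv/= lexx ltW.
have cG x : D x -> {for x, continuous G}.
  by move=> Dx; apply: differentiable_continuous; apply/derivable1_diffP; have [] := dG x Dx.
rewrite (continuous_FTC2 (ab n) (cgn n) (F := G)).
- rewrite -EFinB lee_fin.
  have := GM _ an; have := GM _ bn; rewrite !ler_norml => /andP[_ h1] /andP[h2 _].
  by rewrite lerD// lerNl.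
- split.
  + move=> x xab; have [] := dG x => //; apply: (sD n); exact: subset_itv_oo_cc xab.
  + by apply: cvg_at_right_filter; exact: cG.
  + by apply: cvg_at_left_filter; exact: cG.
- move=> x xab; rewrite derive1E.
  by have [_ ->] := dG x (sD n _ (subset_itv_oo_cc xab)).
Qed.

Lemma continuous_powR_gt0 (p x : R) : (0 < x)%R -> {for x, continuous (@powR R ^~ p)}.
Proof.
move=> x0; apply: differentiable_continuous; apply/derivable1_diffP.
by have [] := is_derive1_powR p x0.
Qed.

Lemma powR_le1 (t p : R) : (0 < t <= 1)%R -> (0 <= p)%R -> (t `^ p <= 1)%R.
Proof.
move=> /andP[t0 t1] p0; have -> : 1%R = (1 `^ p)%R :> R by rewrite powR1.
by apply: ge0_ler_powR => //; rewrite nnegrE ?ltW.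
Qed.

Lemma integral_powR_lty01 (p : R) : (-1 < p)%R ->
  \int[mu]_(t in `]0%R, 1%R[) (t `^ p)%:E < +oo.
Proof.
move=> p1; set q := (p + 1)%R; have q0 : (0 < q)%R by rewrite /q; lra.
(* The shift by two keeps [a 0] strictly below the right endpoint 1, since every interval of the
   exhaustion must be nondegenerate. *)
pose a n : R := (n.+2%:R^-1)%R.
have De : \bigcup_n `[a n, 1%R]%classic = `]0%R, 1%R]%classic.
  apply/seteqP; split=> x /=.
    move=> [n _] /=; rewrite !in_itv/= => /andP[anx ->]; rewrite andbT.
    by apply: lt_le_trans anx; rewrite invr_gt0.
  rewrite in_itv/= => /andP[x0 x1]; exists (Num.truncn x^-1) => //=.
  rewrite in_itv/= x1 andbT /a -[leRHS]invrK lef_pV2 ?posrE ?invr_gt0//.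
  by rewrite ltW// (lt_le_trans (truncnS_gt _))// ler_nat.
rewrite integral_itv_bndo_bndc; last first.
  by apply: measurable_funTS; apply/measurable_EFinP; exact: measurable_powR.
rewrite -De; apply: le_lt_trans (ltry (q^-1 + q^-1)).
apply: (@integral_derivative_bounded a (cst 1%R) (fun x => x `^ q / q)%R).
- by move=> m n mn; rewrite /a lef_pV2 ?posrE// ler_nat.
- by [].
- by move=> n; rewrite /a invf_lt1// ltr1n.
- rewrite De => x /=; rewrite in_itv/= => /andP[x0 x1].
  have := is_derive1_powR q x0 => h.
  rewrite (_ : x `^ p = q^-1 * (q * x `^ (q - 1)))%R; last first.
    by rewrite mulKf ?gt_eqF// /q addrK.
  have -> : (fun x => x `^ q / q)%R = (q^-1 \*: (powR (R:=R) ^~ q))%R.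
    by apply/funext => y /=; rewrite mulrC.
  exact: is_deriveZ.
- by rewrite De => x /=; rewrite in_itv/= => /andP[x0 _]; exact: continuous_powR_gt0.
- by move=> x _; exact: powR_ge0.
- rewrite De => x /=; rewrite in_itv/= => xx.
  rewrite ger0_norm; last by rewrite divr_ge0 ?powR_ge0 ?ltW.
  apply: ler_piMl; first by rewrite invr_ge0 ltW.
  by apply: powR_le1 => //; exact: ltW.
Qed.

Lemma integral_powR_lty1y (p : R) : (p < -1)%R ->
  \int[mu]_(t in `[1%R, +oo[) (t `^ p)%:E < +oo.
Proof.
move=> p1; set q := (p + 1)%R; have q0 : (q < 0)%R by rewrite /q; lra.
have q'0 : (0 < - q)%R by lra.
pose b n : R := (n.+2%:R)%R.
have De : \bigcup_n `[1%R, b n]%classic = `[1%R, +oo[%classic.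
  apply/seteqP; split=> x /=.
    by move=> [n _] /=; rewrite !in_itv/= andbT => /andP[].
  rewrite in_itv/= andbT => x1; exists (Num.truncn x) => //=.
  rewrite in_itv/= x1/= /b ltW// (lt_le_trans (truncnS_gt _))// ler_nat//.
have pos x : (\bigcup_n `[1%R, b n]%classic) x -> (1 <= x)%R.
  by rewrite De /= in_itv/= andbT.
rewrite -De; apply: le_lt_trans (ltry ((- q)^-1 + (- q)^-1)).
apply: (@integral_derivative_bounded (cst 1%R) b (fun x => x `^ q / q)%R).
- by [].
- by move=> m n mn; rewrite /b ler_nat.
- by move=> n; rewrite /b ltr1n.
- move=> x /pos x1; have x0 : (0 < x)%R by lra.
  have := is_derive1_powR q x0 => h.
  rewrite (_ : x `^ p = q^-1 * (q * x `^ (q - 1)))%R; last first.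
    by rewrite mulKf ?lt_eqF// /q addrK.
  have -> : (fun x => x `^ q / q)%R = (q^-1 \*: (powR (R:=R) ^~ q))%R.
    by apply/funext => y /=; rewrite mulrC.
  exact: is_deriveZ.
- by move=> x /pos x1; apply: continuous_powR_gt0; lra.
- by move=> x _; exact: powR_ge0.
- move=> x /pos x1.
  rewrite normrM normfV (ltr0_norm q0) ger0_norm ?powR_ge0//.
  apply: ler_piMl; first by rewrite invr_ge0 ltW.
  by rewrite -(powRr0 x) ler_powR// ltW.
Qed.

(** Used with p = 1 - alpha, the exponent left at t = 1 when a double zero meets the kernel
    bound. *)
Lemma integral_powR1B_lty01 (p : R) : (-1 < p)%R ->
  \int[mu]_(t in `]0%R, 1%R[) ((1 - t) `^ p)%:E < +oo.
Proof.
move=> p1; set q := (p + 1)%R; have q0 : (0 < q)%R by rewrite /q; lra.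
pose b n : R := (1 - n.+2%:R^-1)%R.
have De : \bigcup_n `[0%R, b n]%classic = `[0%R, 1%R[%classic.
  apply/seteqP; split=> x /=.
    move=> [n _] /=; rewrite !in_itv/= => /andP[->]/= xb.
    by apply: le_lt_trans xb _; rewrite /b ltrBlDr ltrDl invr_gt0.
  rewrite in_itv/= => /andP[x0 x1]; exists (Num.truncn (1 - x)^-1) => //=.
  rewrite in_itv/= x0/= /b lerBrDr addrC -lerBrDr -[leRHS]invrK.
  rewrite lef_pV2 ?posrE ?invr_gt0 ?subr_gt0//.
  by rewrite ltW// (lt_le_trans (truncnS_gt _))// ler_nat.
have pos x : (\bigcup_n `[0%R, b n]%classic) x -> (0 <= x < 1)%R.
  by rewrite De /= in_itv/=.
rewrite integral_itv_obnd_cbnd; last first.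
  apply: measurable_funTS; apply/measurable_EFinP.
  apply: (measurableT_comp (measurable_powR p)) => //.
  exact: measurable_funB.
rewrite -De; apply: le_lt_trans (ltry (q^-1 + q^-1)).
apply: (@integral_derivative_bounded (cst 0%R) b (fun x => - q^-1 * (1 - x) `^ q)%R).
- by [].
- by move=> m n mn; rewrite /b lerD2l lerN2 lef_pV2 ?posrE// ler_nat.
- by move=> n; rewrite /b subr_gt0 invf_lt1// ltr1n.
- move=> x /pos /andP[x0 x1].
  have x1' : (0 < 1 - x)%R by lra.
  have h := is_derive1_powR q x1'.
  have h1 : is_derive x 1%R (fun y : R => 1 - y)%R (-1)%R.
    by rewrite -(sub0r 1%R); apply: is_deriveB.
  rewrite (_ : (1 - x) `^ p = - q^-1 * (-1 * (q * (1 - x) `^ (q - 1))))%R; last first.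
    by rewrite mulN1r mulrN mulNr opprK mulKf ?gt_eqF// /q addrK.
  have -> : (fun x => - q^-1 * (1 - x) `^ q)%R =
      ((- q^-1) \*: ((powR (R:=R) ^~ q) \o (fun y => 1 - y)))%R.
    by apply/funext => y /=.
  apply: is_deriveZ.
  by rewrite mulrC; exact: is_derive1_comp.
- move=> x /pos /andP[x0 x1].
  apply: (@continuous_comp _ _ _ (fun y : R => 1 - y)%R (powR (R:=R) ^~ p)).
    by apply: cvgB; [exact: cvg_cst|exact: cvg_id].
  by apply: continuous_powR_gt0; rewrite subr_gt0.
- by move=> x _; exact: powR_ge0.
- move=> x /pos /andP[x0 x1].
  rewrite normrM normrN normfV (gtr0_norm q0) ger0_norm ?powR_ge0//.
  apply: ler_piMr; first by rewrite invr_ge0 ltW.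
  by apply: powR_le1; lra.
Qed.

End power_integrals.

(** * Integrability of the Hardy weight and of kernel moments *)

Section kernel_integrals.
Context {R : realType}.
Local Notation mu := (@lebesgue_measure R).

Lemma powR_gt0D (x p q : R) : (0 < x)%R -> (x `^ (p + q) = x `^ p * x `^ q)%R.
Proof. by move=> x0; rewrite powRD// (gt_eqF x0) implybT. Qed.

(** Both directions come from the tangent inequality 1 + z <= exp z: at z it gives 1 - exp z <= -z,
    and at -z, multiplied by exp z, it gives exp z - 1 <= z exp z. *)
Lemma normB1_expR (z : R) : (`|1 - expR z| <= `|z| * expR `|z|)%R.
Proof.
have h1 := expR_ge1Dx z; have h2 := expR_ge1Dx (- z).
have e0 := expR_gt0 z.
have h3 : (expR z - 1 <= z * expR z)%R.
  have : ((1 - z) * expR z <= 1)%R.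
    by rewrite -[leRHS](expRxMexpNx_1 z) [leRHS]mulrC ler_wpM2r ?expR_ge0.
  lra.
have z0 := normr_ge0 z.
have e1 : (1 <= expR `|z|)%R by rewrite -expR0 ler_expR.
have e2 : (expR z <= expR `|z|)%R by rewrite ler_expR ler_norm.
rewrite ler_norml; apply/andP; split.
  rewrite lerNl opprB; apply: le_trans h3 _; apply: le_trans (ler_norm _) _.
  by rewrite normrM (gtr0_norm e0) ler_wpM2l.
apply: (@le_trans _ _ `|z|%R); last by rewrite ler_peMr.
by have := ler_norm (- z); rewrite normrN; lra.
Qed.

(** Write t^a = exp (a ln t). The factor 2 comes from -ln t <= 1/t - 1 <= 2 (1 - t), and the
    exponential factor from 2 (1 - t) <= 1. *)
Lemma normB1_powR (a t : R) : (2^-1 <= t <= 1)%R ->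
  (`|1 - t `^ a| <= 2 * `|a| * expR `|a| * (1 - t))%R.
Proof.
move=> /andP[t2 t1]; have t0 : (0 < t)%R by lra.
have lnt : (0 <= - ln t <= 2 * (1 - t))%R.
  rewrite oppr_ge0 ln_le0//=.
  have -> : (- ln t = ln (1 + (t^-1 - 1)))%R.
    by rewrite addrC subrK lnV ?posrE.
  have ti : (0 < t^-1)%R by rewrite invr_gt0.
  apply: (le_trans (le_ln1Dx _)); first lra.
  have -> : (t^-1 - 1 = t^-1 * (1 - t))%R by rewrite mulrBr mulr1 mulVf ?gt_eqF.
  rewrite ler_wpM2r ?subr_ge0// -(invrK 2%R) lef_pV2 ?posrE ?invr_gt0//.
rewrite /powR (gt_eqF t0).
apply: le_trans (normB1_expR _) _.
have nz : (`|a * ln t| <= `|a| * (2 * (1 - t)))%R.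
  by rewrite normrM ler_wpM2l// ler0_norm; lra.
have nz1 : (`|a * ln t| <= `|a|)%R.
  by apply: le_trans nz _; rewrite ler_piMr//; lra.
apply: (@le_trans _ _ (`|a| * (2 * (1 - t)) * expR `|a|)%R).
  by apply: ler_pM; rewrite ?expR_ge0 ?ler_expR.
by rewrite le_eqVlt; apply/orP; left; apply/eqP; ring.
Qed.

(** Used with [sigma] equal to alpha - 1 - rho: the lower bounds on [sigma] and [rho + sigma] then
    read rho < alpha and 0 < alpha. Near 0 the product expands into four integrable powers; near 1
    each factor is O(1 - t). *)
Lemma integral_Hardy_weight_lty (alpha rho sigma : R) : (-1 < alpha < 2)%R ->
  (-1 < rho)%R -> (-1 < sigma)%R -> (-1 < rho + sigma)%R ->
  \int[mu]_(t in `]0%R, 1%R[)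
    (`|(1 - t `^ rho) * (1 - t `^ sigma)| * (1 - t) `^ (- alpha - 1))%:E < +oo.
Proof.
move=> /andP[a1 a2] r1 s1 rs1.
(* [K] bounds (1 - t)^(-alpha-1) for t <= 1/2, and [M] is the product of the two constants of
   [normB1_powR]. The majorant [B] adds the bounds for both sides of 1/2, so the interval need not
   be cut. *)
pose K : R := (2^-1 `^ (- alpha - 1))%R.
pose M : R := (2 * `|rho| * expR `|rho| * (2 * `|sigma| * expR `|sigma|))%R.
have K0 : (0 <= K)%R by exact: powR_ge0.
have M0 : (0 <= M)%R by rewrite /M !mulr_ge0 ?expR_ge0.
pose B t : R := (K * (t `^ 0 + t `^ rho + t `^ sigma + t `^ (rho + sigma))
  + M * (1 - t) `^ (1 - alpha))%R.
have mpow p : measurable_fun setT (fun t : R => t `^ p)%R by exact: measurable_powR.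
have m1t : measurable_fun setT (fun t : R => 1 - t)%R by exact: measurable_funB.
have mpow1 p : measurable_fun setT (fun t : R => (1 - t) `^ p)%R.
  exact: (measurableT_comp (mpow p) m1t).
have mI (f : R -> R) : measurable_fun setT f ->
    measurable_fun (`]0%R, 1%R[%classic : set R) (EFin \o f).
  by move=> mf; apply: measurable_funTS; exact/measurable_EFinP.
have mK p : measurable_fun setT (fun t : R => K * t `^ p)%R by exact: measurable_funM.
apply: (@le_lt_trans _ _ (\int[mu]_(t in `]0%R, 1%R[) (B t)%:E)).
  apply: ge0_le_integral => //.
  - by move=> t _; rewrite lee_fin mulr_ge0 ?powR_ge0.
  - apply: mI; apply: measurable_funM => //; apply: measurableT_comp => //.
    by apply: measurable_funM; exact: measurable_funB.
  - apply: mI; apply: measurable_funD; apply: measurable_funM => //.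
    by do 3!(apply: measurable_funD; last exact: mpow).
  move=> t /=; rewrite in_itv/= => /andP[t0 t1].
  have t1' : (0 < 1 - t)%R by lra.
  rewrite lee_fin /B; have [th|th] := leP t 2^-1%R.
    apply: (@le_trans _ _ (K * (t `^ 0 + t `^ rho + t `^ sigma + t `^ (rho + sigma)))%R); last first.
      by rewrite lerDl mulr_ge0 ?powR_ge0.
    rewrite mulrC; apply: ler_pM => //; first exact: powR_ge0.
      have -> : (- alpha - 1 = - (alpha + 1))%R by ring.
      rewrite /K (_ : - alpha - 1 = - (alpha + 1))%R; last by ring.
      rewrite !powRN lef_pV2 ?posrE ?powR_gt0//.
      by apply: ge0_ler_powR; rewrite ?nnegrE; lra.
    rewrite normrM powRr0 powR_gt0D//.
    apply: (@le_trans _ _ ((1 + t `^ rho) * (1 + t `^ sigma))%R).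
      by apply: ler_pM => //; apply: le_trans (ler_normB _ _) _; rewrite normr1 ger0_norm ?powR_ge0.
    by rewrite le_eqVlt; apply/orP; left; apply/eqP; ring.
  apply: (@le_trans _ _ (M * (1 - t) `^ (1 - alpha))%R); last first.
    by rewrite lerDr mulr_ge0// !addr_ge0 ?powR_ge0.
  have -> : (1 - alpha = 1 + (1 + (- alpha - 1)))%R by ring.
  rewrite (powR_gt0D _ 1%R (1 + (- alpha - 1))%R)//.
  rewrite (powR_gt0D _ 1%R (- alpha - 1)%R)// powRr1; last exact: ltW.
  have tt : (2^-1 <= t <= 1)%R by rewrite !ltW.
  rewrite normrM !mulrA ler_wpM2r ?powR_ge0//.
  apply: (@le_trans _ _ ((2 * `|rho| * expR `|rho| * (1 - t)) *
    (2 * `|sigma| * expR `|sigma| * (1 - t)))%R).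
    by apply: ler_pM => //; exact: normB1_powR.
  by rewrite /M le_eqVlt; apply/orP; left; apply/eqP; ring.
have p0 p (t : R) : 0 <= (t `^ p)%:E by rewrite lee_fin powR_ge0.
have p0' p (t : R) : 0 <= ((1 - t) `^ p)%:E by rewrite lee_fin powR_ge0.
rewrite /B; under eq_integral do rewrite EFinD !EFinM !EFinD.
have mE p : measurable_fun (`]0%R, 1%R[%classic : set R) (fun t => (t `^ p)%:E) by exact: mI.
have mE1 p : measurable_fun (`]0%R, 1%R[%classic : set R) (fun t => ((1 - t) `^ p)%:E) by exact: mI.
pose I01 : set R := `]0%R, 1%R[%classic.
have mI01 : measurable I01 by exact: measurable_itv.
have intD (f g : R -> \bar R) : measurable_fun I01 f -> measurable_fun I01 g ->
    (forall t, 0 <= f t) -> (forall t, 0 <= g t) ->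
    \int[mu]_(t in I01) f t < +oo -> \int[mu]_(t in I01) g t < +oo ->
    \int[mu]_(t in I01) (f t + g t) < +oo.
  by move=> mf mg f0 g0 fy gy; rewrite ge0_integralD//; exact: lte_add_pinfty.
have intZ (c : R) (f : R -> \bar R) : (0 <= c)%R -> measurable_fun I01 f -> (forall t, 0 <= f t) ->
    \int[mu]_(t in I01) f t < +oo -> \int[mu]_(t in I01) (c%:E * f t) < +oo.
  by move=> c0 mf f0 fy; rewrite ge0_integralZl_EFin// lte_mul_pinfty// lee_fin.
have mS2 : measurable_fun I01 (fun t => (t `^ 0)%:E + (t `^ rho)%:E) by exact: emeasurable_funD.
have mS3 : measurable_fun I01 (fun t => (t `^ 0)%:E + (t `^ rho)%:E + (t `^ sigma)%:E).
  exact: emeasurable_funD.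
have mS4 : measurable_fun I01
    (fun t => (t `^ 0)%:E + (t `^ rho)%:E + (t `^ sigma)%:E + (t `^ (rho + sigma))%:E).
  exact: emeasurable_funD.
apply: (intD); [exact: measurable_funeM|by apply: measurable_funeM; exact: mE1| | | |].
- by move=> t; rewrite mule_ge0// !adde_ge0.
- by move=> t; rewrite mule_ge0.
- apply: (intZ) => //; first by move=> t; rewrite !adde_ge0.
  have Ip p : (-1 < p)%R -> \int[mu]_(t in I01) (t `^ p)%:E < +oo by exact: integral_powR_lty01.
  apply: (intD) => //; [by move=> t; rewrite !adde_ge0| |exact: Ip].
  apply: (intD) => //; [by move=> t; rewrite !adde_ge0| |exact: Ip].
  by apply: (intD) => //; apply: Ip => //; lra.
- apply: (intZ) => //.
  by apply: integral_powR1B_lty01; lra.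
Qed.

(** The integrand is at most t^s on (0, 1) and at most t^(s-alpha-1) beyond 1; the two bounds on [s]
    are the conditions at the two ends. *)
Lemma integral_powR_1D_lty (alpha s : R) : (-1 < s < alpha)%R ->
  \int[mu]_(t in `]0%R, +oo[) (t `^ s * (1 + t) `^ (- alpha - 1))%:E < +oo.
Proof.
move=> /andP[s1 sa].
have mpow p : measurable_fun setT (fun t : R => t `^ p)%R by exact: measurable_powR.
have m1t : measurable_fun setT (fun t : R => 1 + t)%R by exact: measurable_funD.
have mf : measurable_fun setT (fun t : R => (t `^ s * (1 + t) `^ (- alpha - 1))%:E).
  apply/measurable_EFinP; apply: measurable_funM => //.
  exact: (measurableT_comp (mpow (- alpha - 1)%R) m1t).
have -> : `]0%R, +oo[%classic = `]0%R, 1%R[%classic `|` `[1%R, +oo[%classic :> set R.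
  apply/seteqP; split=> y /=; rewrite !in_itv/= !andbT.
    by move=> y0; case: (ltP y 1%R) => h; [left; rewrite y0|right].
  by case=> [/andP[]//|]; exact: lt_le_trans.
rewrite ge0_integral_setU//; last 3 first.
- exact: measurable_funTS.
- by move=> t _; rewrite lee_fin mulr_ge0 ?powR_ge0.
- apply/disj_set2P/seteqP; split=> y //= []; rewrite !in_itv/= andbT => /andP[_].
  by rewrite ltNge => /negbTE ->.
have f0 (t : R) : 0 <= (t `^ s * (1 + t) `^ (- alpha - 1))%:E.
  by rewrite lee_fin mulr_ge0 ?powR_ge0.
have ap : (- alpha - 1 = - (alpha + 1))%R by ring.
apply: lte_add_pinfty.
- apply: le_lt_trans (integral_powR_lty01 s _) => //.
  apply: ge0_le_integral => //; first exact: measurable_funTS.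
    by apply: measurable_funTS; exact/measurable_EFinP.
  move=> t /=; rewrite in_itv/= => /andP[t0 t1]; rewrite lee_fin.
  rewrite ler_piMr ?powR_ge0// ap powRN invf_le1 ?powR_gt0//; last lra.
  by rewrite -[leLHS](powRr0 (1 + t)%R); apply: ler_powR; lra.
- apply: le_lt_trans (integral_powR_lty1y (s - alpha - 1)%R _); last lra.
  apply: ge0_le_integral => //; first exact: measurable_funTS.
    by apply: measurable_funTS; exact/measurable_EFinP.
  move=> t /=; rewrite in_itv/= andbT => t1; rewrite lee_fin.
  have t0 : (0 < t)%R by lra.
  rewrite -addrA (powR_gt0D t s)// ler_wpM2l ?powR_ge0// ap !powRN.
  rewrite lef_pV2 ?posrE ?powR_gt0//; last lra.
  by apply: ge0_ler_powR; rewrite ?nnegrE; lra.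
Qed.

End kernel_integrals.

(** * The identity for equal signs *)

(** The only cancellation performed on possibly infinite quantities: [p] and [q] are real, while [a]
    and [b] may be [+oo]. *)
Lemma addeEFin_inj (R : realType) (a b : \bar R) (p q : R) :
  a + p%:E = b + q%:E -> a = b + (q - p)%:E.
Proof. by move=> ab; rewrite EFinB addeA -ab addeK. Qed.

Section ground_state_identities.
Context {R : realType}.
Local Notation mu := (@lebesgue_measure R).
Local Notation pos := (`]0%R, +oo[%classic : set R).
Local Notation I01 := (`]0%R, 1%R[%classic : set R).
Variables (alpha rho : R) (kap : R -> R -> \bar R).
Hypotheses (mkap : jointly_measurable kap) (kap0 : forall x y, 0 <= kap x y).
Hypothesis homkap : forall x y t, (0 < t)%R ->
  kap (t * x)%R (t * y)%R = (t `^ (- alpha - 1))%:E * kap x y.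

Definition half_line_norm (v : R -> R) : \bar R :=
  \int[mu]_(x in pos) (v x ^+ 2 * x `^ (- alpha))%:E.

Lemma half_line_norm_ge0 (v : R -> R) : 0 <= half_line_norm v.
Proof. by apply: integral_ge0 => x _; rewrite lee_fin mulr_ge0 ?sqr_ge0 ?powR_ge0. Qed.

(** The Jacobian [x] times the homogeneity factor x^(-alpha-1) is the Hardy weight x^(-alpha). *)
Lemma homogeneous_kernel_polar (p x t : R) : (0 < x)%R ->
  x%:E * (p%:E * kap x (x * t)%R) = (p * x `^ (- alpha))%:E * kap 1%R t.
Proof.
move=> x0; have -> : kap x (x * t)%R = (x `^ (- alpha - 1))%:E * kap 1%R t.
  by rewrite -homkap// mulr1.
rewrite !muleA -!EFinM; congr (_%:E * _).
rewrite [in RHS](_ : - alpha = 1 + (- alpha - 1))%R; last by ring.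
by rewrite (powR_gt0D x 1%R)// powRr1 ?ltW// mulrCA mulrA.
Qed.

Lemma measurable_powR_comp d (T : measurableType d) (p : R) (f : T -> R) :
  measurable_fun setT f -> measurable_fun setT (fun t => f t `^ p)%R.
Proof. by move=> mf; exact: (measurableT_comp (measurable_powR p) mf). Qed.

Lemma measurable_fst_comp (f : R -> R) : measurable_fun setT f ->
  measurable_fun [set: R * R] (fun z => f z.1).
Proof. by move=> mf; exact: (measurableT_comp mf measurable_fst). Qed.

Lemma measurable_snd_comp (f : R -> R) : measurable_fun setT f ->
  measurable_fun [set: R * R] (fun z => f z.2).
Proof. by move=> mf; exact: (measurableT_comp mf measurable_snd). Qed.

Lemma jointly_measurable_weight (p : R -> R -> R) :
  measurable_fun setT (fun z : R * R => p z.1 z.2) ->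
  jointly_measurable (fun x y => (p x y)%:E * kap x y).
Proof.
by move=> mp; apply: emeasurable_funM => //; exact/measurable_EFinP.
Qed.

(** Under the dilation the measure contributes t^(-1) and the weight t^alpha. *)
Lemma half_line_normZ (v : R -> R) (t : R) : measurable_fun setT v -> (0 < t)%R ->
  \int[mu]_(x in pos) (v (x * t)%R ^+ 2 * x `^ (- alpha))%:E =
  (t `^ (alpha - 1))%:E * half_line_norm v.
Proof.
move=> mv t0.
have mf : measurable_fun setT (fun x : R => (v x ^+ 2 * x `^ (- alpha))%:E).
  apply/measurable_EFinP; apply: measurable_funM; last exact: measurable_powR.
  exact: measurable_funX.
have f0 (x : R) : 0 <= (v x ^+ 2 * x `^ (- alpha))%:E.
  by rewrite lee_fin mulr_ge0 ?sqr_ge0 ?powR_ge0.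
rewrite /half_line_norm [in RHS](ge0_integral_posZ t
  (fun x : R => (v x ^+ 2 * x `^ (- alpha))%:E))// muleA -EFinM.
rewrite -ge0_integralZl_EFin//; last 2 first.
- apply: measurable_funTS; apply: (measurableT_comp mf).
  exact: mulrl_measurable.
- by rewrite mulr_ge0 ?powR_ge0 ?ltW.
apply: eq_integral => x; rewrite inE/= in_itv/= andbT => x0.
rewrite -EFinM; congr (_%:E); rewrite (mulrC x t) powRM ?ltW//.
have tE : (t `^ (alpha - 1) * t * t `^ (- alpha) = 1)%R.
  rewrite -{2}(powRr1 (ltW t0)) -!powR_gt0D//.
  by rewrite (_ : _ + _ = 0)%R ?powRr0//; ring.
by rewrite -[LHS]mul1r -[X in (X * _ = _)%R]tE; ring.
Qed.

Definition difference_form (a b : R -> R) x y : \bar R :=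
  ((a x - b y) ^+ 2)%:E * kap x y.

(** [r] and [s] are the ground-state constants on the half-lines of [x] and [y]: (1, 1) for positive
    pairs, (r, r) for negative and (1, r) for mixed ones. Likewise [a] and [b] are [u] or its
    reflection. *)
Definition ground_state_form (r s : R) (a b : R -> R) x y : \bar R :=
  ((a x / (r * x `^ rho) - b y / (s * y `^ rho)) ^+ 2
   * (r * x `^ rho) * (s * y `^ rho))%:E * kap x y.

Lemma difference_form_measurable (a b : R -> R) :
  measurable_fun setT a -> measurable_fun setT b ->
  jointly_measurable (difference_form a b).
Proof.
move=> ma mb; apply: (jointly_measurable_weight (fun x y => (a x - b y) ^+ 2)%R).
apply: measurable_funX; apply: measurable_funB.
  exact: measurable_fst_comp.
exact: measurable_snd_comp.
Qed.

Lemma ground_state_form_measurable (r s : R) (a b : R -> R) :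
  measurable_fun setT a -> measurable_fun setT b ->
  jointly_measurable (ground_state_form r s a b).
Proof.
move=> ma mb.
apply: (jointly_measurable_weight (fun x y => (a x / (r * x `^ rho) - b y / (s * y `^ rho)) ^+ 2
   * (r * x `^ rho) * (s * y `^ rho))%R).
have mh c : measurable_fun setT (fun x : R => c * x `^ rho)%R.
  by apply: measurable_funM => //; exact: measurable_powR.
have mq (f : R -> R) c : measurable_fun setT f ->
    measurable_fun setT (fun x => f x / (c * x `^ rho))%R.
  move=> mf; apply: measurable_funM => //.
  under eq_fun do rewrite invfM -powRN.
  by apply: measurable_funM => //; exact: measurable_powR.
apply: measurable_funM; first apply: measurable_funM.
- apply: measurable_funX; apply: measurable_funB.
    exact: (measurable_fst_comp (fun x => a x / (r * x `^ rho))%R (mq _ _ ma)).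
  exact: (measurable_snd_comp (fun x => b x / (s * x `^ rho))%R (mq _ _ mb)).
- exact: measurable_fst_comp (mh r).
- exact: measurable_snd_comp (mh s).
Qed.

Lemma difference_form_ge0 (a b : R -> R) x y : 0 <= difference_form a b x y.
Proof. by rewrite mule_ge0// lee_fin sqr_ge0. Qed.

Lemma ground_state_form_ge0 (r s : R) (a b : R -> R) x y : (0 < r)%R -> (0 < s)%R ->
  0 <= ground_state_form r s a b x y.
Proof.
move=> r0 s0; have h c z : (0 < c)%R -> (0 <= c * z `^ rho)%R.
  by move=> c0; rewrite mulr_ge0 ?powR_ge0// ltW.
by rewrite mule_ge0// lee_fin mulr_ge0 ?h// mulr_ge0 ?h// sqr_ge0.
Qed.

Section same_sign.
Variables (v : R -> R) (c : R).
Hypotheses (alpha02 : (0 < alpha < 2)%R) (rhoI : (-1 < rho < alpha)%R).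
Hypotheses (mv : measurable_fun setT v) (c0 : (0 <= c)%R).
Hypothesis kap_le : forall t, (0 < t < 1)%R -> kap 1%R t <= (c * (1 - t) `^ (- alpha - 1))%:E.
Hypothesis vfin : half_line_norm v < +oo.

Let g (t : R) : R := ((1 - t `^ rho) * (1 - t `^ (alpha - 1 - rho)))%R.
Let n := fine (half_line_norm v).

Let n0 : (0 <= n)%R.
Proof. exact/fine_ge0/half_line_norm_ge0. Qed.

Let nE : half_line_norm v = n%:E.
Proof. by rewrite fineK// ge0_fin_numE// half_line_norm_ge0. Qed.

Let mkap1 : measurable_fun setT (kap 1%R).
Proof. exact: jointly_measurable1. Qed.

Let mg : measurable_fun setT g.
Proof.
apply: measurable_funM; apply: measurable_funB => //; exact: measurable_powR.
Qed.

Let m1t p : measurable_fun setT (fun t : R => (1 - t) `^ p)%R.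
Proof. by apply: measurable_powR_comp; exact: measurable_funB. Qed.

Let kap_fin t : I01 t -> kap 1%R t \is a fin_num.
Proof.
rewrite /= in_itv/= => t01; rewrite ge0_fin_numE//.
by apply: le_lt_trans (kap_le _ t01) _; exact: ltry.
Qed.

(** Any [f] dominated by |g| is allowed, so as to cover the positive and the negative part of [g] at
    once. *)
Lemma Hardy_weight_integral_lty (f : R -> R) : measurable_fun setT f ->
  (forall t, 0 <= f t <= `|g t|)%R ->
  \int[mu]_(t in I01) ((f t)%:E * kap 1%R t) < +oo.
Proof.
move=> mf fg.
have f0 t : 0 <= (f t)%:E by have /andP[] := fg t; rewrite lee_fin.
have mW : measurable_fun I01 (fun t => (`|g t| * (1 - t) `^ (- alpha - 1))%:E).
  apply: measurable_funTS; apply/measurable_EFinP; apply: measurable_funM => //.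
  exact: measurableT_comp.
apply: (@le_lt_trans _ _ (\int[mu]_(t in I01) (c%:E * (`|g t| * (1 - t) `^ (- alpha - 1))%:E))).
  apply: ge0_le_integral => //.
  - by move=> t _; rewrite mule_ge0.
  - by apply: measurable_funTS; apply: emeasurable_funM => //; exact/measurable_EFinP.
  - exact: measurable_funeM.
  move=> t /=; rewrite in_itv/= => t01; rewrite -EFinM mulrCA EFinM.
  by apply: lee_pmul => //; [rewrite lee_fin; have /andP[] := fg t|exact: kap_le].
rewrite ge0_integralZl_EFin//; last first.
  by move=> t _; rewrite lee_fin mulr_ge0// powR_ge0.
apply: lte_mul_pinfty; [by rewrite lee_fin|by []|].
have /andP[a0 a2] := alpha02; have /andP[r1 ra] := rhoI.
by apply: integral_Hardy_weight_lty; [apply/andP; split; lra|lra..].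
Qed.

(** On (0, 1) the sign of [g] is that of rho (alpha - 1 - rho). Splitting [g] into its two parts
    treats all cases alike, with nonnegative integrands. *)
Let gp (t : R) : R := Num.max (g t) 0%R.
Let gm (t : R) : R := Num.max (- g t)%R 0%R.

Let mgp : measurable_fun setT gp.
Proof. exact: measurable_maxr. Qed.

Let mgm : measurable_fun setT gm.
Proof. by apply: measurable_maxr => //; exact: measurable_funN. Qed.

Let gp_le t : (0 <= gp t <= `|g t|)%R.
Proof. by rewrite /gp le_max lexx orbT ge_max ler_norm normr_ge0. Qed.

Let gm_le t : (0 <= gm t <= `|g t|)%R.
Proof. by rewrite /gm le_max lexx orbT ge_max -normrN ler_norm normr_ge0. Qed.

Let P := \int[mu]_(t in I01) ((gp t)%:E * kap 1%R t).
Let M := \int[mu]_(t in I01) ((gm t)%:E * kap 1%R t).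

Let int_fin (f : R -> R) : measurable_fun setT f -> (forall t, 0 <= f t <= `|g t|)%R ->
  \int[mu]_(t in I01) ((f t)%:E * kap 1%R t) \is a fin_num.
Proof.
move=> mf fg; rewrite ge0_fin_numE; first exact: Hardy_weight_integral_lty.
by apply: integral_ge0 => t _; rewrite mule_ge0// lee_fin; have /andP[] := fg t.
Qed.

Let HardyE : \int[mu]_(t in I01) ((g t)%:E * kap 1%R t) = P - M.
Proof.
rewrite integralE; congr (_ - _); apply: eq_integral => t; rewrite inE => t01.
- rewrite funeposE -(fineK (kap_fin _ t01)) -!EFinM -EFin_max.
  by rewrite maxr_pMl ?mul0r// fine_ge0.
- rewrite funenegE -(fineK (kap_fin _ t01)) -!EFinM -EFinN -EFin_max.
  by rewrite -mulNr maxr_pMl ?mul0r// fine_ge0.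
Qed.

Lemma Hardy_constant_fin_num :
  \int[mu]_(t in I01) ((g t)%:E * kap 1%R t) \is a fin_num.
Proof. by rewrite HardyE fin_numB !int_fin. Qed.

Let sq_weight (f w : R -> R) : measurable_fun setT f -> measurable_fun setT w ->
  measurable_fun pos (fun x : R => (f x ^+ 2 * w x)%:E).
Proof.
move=> mf mw; apply: measurable_funTS; apply/measurable_EFinP.
by apply: measurable_funM => //; exact: measurable_funX.
Qed.

(* In general only the combined coefficient g t, which vanishes to second order
   at t = 1, is integrable against kap 1 t; so the two square terms are added up
   for each fixed ratio t = y / x before integrating in t. *)
Let fixed_ratio t : I01 t ->
  \int[mu]_(x in pos) ((v x - v (x * t)) ^+ 2 * x `^ (- alpha))%:E =
  \int[mu]_(x in pos) ((v x - v (x * t) * t `^ (- rho)) ^+ 2 * (t `^ rho * x `^ (- alpha)))%:E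
  + (g t * n)%:E.
Proof.
rewrite /= in_itv/= => /andP[t0 t1].
have mvt : measurable_fun setT (fun x : R => v (x * t)%R).
  by apply: (measurableT_comp mv); exact: mulrr_measurable.
have mx : measurable_fun setT (fun x : R => x `^ (- alpha))%R by exact: measurable_powR.
set A := LHS; set B := \int[mu]_(x in pos) _.
have AB : A + ((t `^ rho * n)%:E + (t `^ (- rho) * (t `^ (alpha - 1) * n))%:E) =
    B + (n%:E + (t `^ (alpha - 1) * n)%:E).
  have N1 : n%:E = \int[mu]_(x in pos) (v x ^+ 2 * x `^ (- alpha))%:E by rewrite -nE.
  have N2 : (t `^ (alpha - 1) * n)%:E = \int[mu]_(x in pos) (v (x * t)%R ^+ 2 * x `^ (- alpha))%:E.
    by rewrite half_line_normZ// nE.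
  rewrite 2![in LHS]EFinM N2 N1.
  rewrite -!ge0_integralZl_EFin ?powR_ge0//; last 4 first.
  - by move=> x _; rewrite lee_fin mulr_ge0 ?sqr_ge0 ?powR_ge0.
  - exact: sq_weight.
  - by move=> x _; rewrite lee_fin mulr_ge0 ?sqr_ge0 ?powR_ge0.
  - exact: sq_weight.
  have sq0 (a b x : R) : (0 <= b)%R -> 0 <= (a ^+ 2 * (b * x `^ (- alpha)))%:E.
    by move=> b0; rewrite lee_fin mulr_ge0 ?sqr_ge0// mulr_ge0 ?powR_ge0.
  have sq1 (a x : R) : 0 <= (a ^+ 2 * (x `^ (- alpha)))%:E.
    by rewrite lee_fin mulr_ge0 ?sqr_ge0 ?powR_ge0.
  have mA : measurable_fun pos (fun x : R => ((v x - v (x * t)) ^+ 2 * x `^ (- alpha))%:E).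
    by apply: sq_weight => //; exact: measurable_funB.
  have mB : measurable_fun pos
      (fun x : R => ((v x - v (x * t) * t `^ (- rho)) ^+ 2 * (t `^ rho * x `^ (- alpha)))%:E).
    apply: sq_weight; last by apply: measurable_funM.
    by apply: measurable_funB => //; apply: measurable_funM.
  have m1 : measurable_fun pos (fun x : R => (v x ^+ 2 * x `^ (- alpha))%:E) by exact: sq_weight.
  have m2 : measurable_fun pos (fun x : R => (v (x * t)%R ^+ 2 * x `^ (- alpha))%:E)
    by exact: sq_weight.
  have mz (p : R) f : measurable_fun pos f -> measurable_fun pos (fun x : R => p%:E * f x).
    by move=> mf; exact: measurable_funeM.
  have z1 (x : R) : 0 <= (t `^ rho)%:E * (v x ^+ 2 * x `^ (- alpha))%:E.
    by rewrite mule_ge0// lee_fin powR_ge0.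
  have z2 (x : R) : 0 <= (t `^ (- rho))%:E * (v (x * t)%R ^+ 2 * x `^ (- alpha))%:E.
    by rewrite mule_ge0// lee_fin powR_ge0.
  have zB (x : R) : 0 <= ((v x - v (x * t) * t `^ (- rho)) ^+ 2 * (t `^ rho * x `^ (- alpha)))%:E.
    by apply: sq0; exact: powR_ge0.
  have m3 := mz (t `^ rho)%R _ m1; have m4 := mz (t `^ (- rho))%R _ m2.
  have m34 := emeasurable_funD m3 m4; have m12 := emeasurable_funD m1 m2.
  rewrite /A /B -2?ge0_integralD//; last by move=> x _; rewrite adde_ge0.
  rewrite -2?ge0_integralD//; last by move=> x _; rewrite adde_ge0.
  apply: eq_integral => x _; rewrite -!EFinM -!EFinD; congr (_%:E).
  have tt : (t `^ rho * t `^ (- rho) = 1)%R by rewrite -powR_gt0D// subrr powRr0.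
  move: tt; set p := (t `^ rho)%R; set q := (t `^ (- rho))%R => pq.
  set a := v x; set b := v _; set w := (x `^ _)%R.
  (* The identity holds only modulo p q = 1; adding the right multiple of p q - 1 makes it a
     polynomial identity. *)
  transitivity ((a - b) ^+ 2 * w + p * a ^+ 2 * w + q * b ^+ 2 * w
     + (p * q - 1) * (q * b ^+ 2 * w - 2 * a * b * w))%R; first by rewrite pq; ring.
  ring.
rewrite (addeEFin_inj _ _ _ _ _ AB); congr (_ + _%:E).
(* The second exponent alpha - 1 - rho in [g] arises here: t^(-rho) from the ground state meets
   t^(alpha-1) from scaling. *)
have gE : (g t = 1 - t `^ rho - t `^ (- rho) * t `^ (alpha - 1) + t `^ (alpha - 1))%R.
  rewrite /g mulrBl mul1r mulrBr mulr1 -!powR_gt0D//.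
  rewrite (_ : - rho + (alpha - 1) = alpha - 1 - rho)%R; last by ring.
  rewrite (_ : rho + (alpha - 1 - rho) = alpha - 1)%R; last by ring.
  by ring.
by rewrite gE; ring.
Qed.

Let mx : measurable_fun [set: R * R] (fun z => z.1%:E).
Proof. by apply/measurable_EFinP; exact: measurable_fst. Qed.

Let mpolar (F : R -> R -> \bar R) : jointly_measurable F ->
  jointly_measurable (fun t x => x%:E * F x (x * t)%R).
Proof.
move=> mF; apply: (jointly_measurable_swap (fun x t => x%:E * F x (x * t)%R)).
apply: emeasurable_funM => //.
apply: (jointly_measurable_comp _ _ F fst (fun z : R * R => z.1 * z.2)%R) => //.
exact: measurable_funM.
Qed.

Let polar_measurable (F : R -> R -> \bar R) : jointly_measurable F -> (forall x y, 0 <= F x y) ->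
  measurable_fun setT (fun t => \int[mu]_(x in pos) (x%:E * F x (x * t)%R)).
Proof.
move=> mF F0; apply: (@measurable_int_in _ pos (fun t x => x%:E * F x (x * t)%R)) => //.
  exact: mpolar.
by move=> t x /=; rewrite in_itv/= andbT => x0; rewrite mule_ge0// lee_fin ltW.
Qed.

Let polar_integral (p : R -> R -> R) (q : R -> R) t : measurable_fun setT q ->
  (forall x, 0 <= q x)%R -> (forall x, (0 < x)%R -> p x (x * t)%R * x `^ (- alpha) = q x)%R ->
  \int[mu]_(x in pos) (x%:E * ((p x (x * t)%R)%:E * kap x (x * t)%R)) =
  \int[mu]_(x in pos) (q x)%:E * kap 1%R t.
Proof.
move=> mq q0 pq; rewrite -ge0_integralZr//; last 2 first.
- by apply: measurable_funTS; exact/measurable_EFinP.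
- by move=> x _; rewrite lee_fin.
apply: eq_integral => x; rewrite inE/= in_itv/= andbT => x0.
by rewrite homogeneous_kernel_polar// pq.
Qed.

(** The constant [r] cancels inside the form; it is carried along to match the ground state on
    either half-line. *)
Lemma same_sign_identity (r : R) : (0 < r)%R ->
  \int[mu]_(t in I01) \int[mu]_(x in pos) (x%:E * difference_form v v x (x * t)%R) =
  \int[mu]_(t in I01) \int[mu]_(x in pos) (x%:E * ground_state_form r r v v x (x * t)%R) +
  half_line_norm v * \int[mu]_(t in I01) ((g t)%:E * kap 1%R t).
Proof.
move=> r0.
set LA := fun t => \int[mu]_(x in pos) (x%:E * difference_form v v x (x * t)%R).
set LB := fun t => \int[mu]_(x in pos) (x%:E * ground_state_form r r v v x (x * t)%R).
rewrite -/(\int[mu]_(t in I01) LA t) -/(\int[mu]_(t in I01) LB t).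
have mLA : measurable_fun I01 LA.
  apply: measurable_funTS; apply: polar_measurable.
    exact: difference_form_measurable.
  exact: difference_form_ge0.
have mLB : measurable_fun I01 LB.
  apply: measurable_funTS; apply: polar_measurable.
    exact: ground_state_form_measurable.
  by move=> x y; exact: ground_state_form_ge0.
have LA0 t : 0 <= LA t.
  apply: integral_ge0 => x /=; rewrite in_itv/= andbT => x0.
  by rewrite mule_ge0 ?difference_form_ge0// lee_fin ltW.
have LB0 t : 0 <= LB t.
  apply: integral_ge0 => x /=; rewrite in_itv/= andbT => x0.
  by rewrite mule_ge0 ?ground_state_form_ge0// lee_fin ltW.
have mvt (t : R) : measurable_fun setT (fun x : R => v (x * t)%R).
  by apply: (measurableT_comp mv); exact: mulrr_measurable.
have mxa : measurable_fun setT (fun x : R => x `^ (- alpha))%R by exact: measurable_powR.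
(* The negative part of [g] is moved to the left, so that both sides are nonnegative and can be
   integrated in [t] term by term. *)
have main t : I01 t ->
    LA t + n%:E * ((gm t)%:E * kap 1%R t) = LB t + n%:E * ((gp t)%:E * kap 1%R t).
  move=> t01; have t0 : (0 < t)%R by move: t01; rewrite /= in_itv/= => /andP[].
  rewrite /LA /LB (polar_integral (fun x y => (v x - v y) ^+ 2)%R
    (fun x => (v x - v (x * t)) ^+ 2 * x `^ (- alpha))%R)//; last 2 first.
  - by apply: measurable_funM => //; apply: measurable_funX; exact: measurable_funB.
  - by move=> x; rewrite mulr_ge0 ?sqr_ge0 ?powR_ge0.
  rewrite (polar_integral (fun x y => (v x / (r * x `^ rho) - v y / (r * y `^ rho)) ^+ 2
     * (r * x `^ rho) * (r * y `^ rho))%R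
    (fun x => (v x - v (x * t) * t `^ (- rho)) ^+ 2 * (t `^ rho * x `^ (- alpha)))%R); last 3 first.
  - apply: measurable_funM; last exact: measurable_funM.
    by apply: measurable_funX; apply: measurable_funB => //; exact: measurable_funM.
  - by move=> x; rewrite mulr_ge0 ?sqr_ge0// mulr_ge0 ?powR_ge0.
  - move=> x x0; rewrite powRM ?ltW// (powRN t) [RHS]mulrA; congr (_ * _)%R.
    have X0 := powR_gt0 rho x0; have T0 := powR_gt0 rho t0.
    move: (x `^ rho)%R (t `^ rho)%R X0 T0 => X T X0 T0.
    by field; rewrite !gt_eqF.
  rewrite fixed_ratio// -(fineK (kap_fin _ t01)).
  have K0 : (0 <= fine (kap 1%R t))%R by exact: fine_ge0.
  have -> : gp t = (g t + gm t)%R.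
    rewrite /gp /gm /Num.max; case: ltP => h1; case: ltP => h2; lra.
  set B := \int[mu]_(x in pos) _; set K := fine _.
  rewrite muleDl//; last exact: fin_num_adde_defl.
  by rewrite -addeA -!EFinM -EFinD; congr (_ + _%:E); ring.
have I1 : \int[mu]_(t in I01) (LA t + n%:E * ((gm t)%:E * kap 1%R t)) =
          \int[mu]_(t in I01) (LB t + n%:E * ((gp t)%:E * kap 1%R t)).
  by apply: eq_integral => t; rewrite inE; exact: main.
have mgk (f : R -> R) : measurable_fun setT f -> measurable_fun I01 (fun t => (f t)%:E * kap 1%R t).
  by move=> mf; apply: measurable_funTS; apply: emeasurable_funM => //; exact/measurable_EFinP.
have gm0 t : 0 <= (gm t)%:E * kap 1%R t by rewrite mule_ge0// lee_fin; have /andP[] := gm_le t.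
have gp0 t : 0 <= (gp t)%:E * kap 1%R t by rewrite mule_ge0// lee_fin; have /andP[] := gp_le t.
have mm := mgk _ mgm; have mp := mgk _ mgp.
have split (L f : R -> \bar R) : measurable_fun I01 L -> measurable_fun I01 f ->
    (forall t, 0 <= L t) -> (forall t, 0 <= f t) ->
    \int[mu]_(t in I01) (L t + n%:E * f t) =
    \int[mu]_(t in I01) L t + n%:E * \int[mu]_(t in I01) f t.
  move=> mL mf L0 f0; rewrite -ge0_integralZl_EFin// ge0_integralD//.
    by move=> t _; rewrite mule_ge0.
  exact: measurable_funeM.
rewrite (split _ _ mLA mm LA0 gm0) (split _ _ mLB mp LB0 gp0) -/P -/M in I1.
rewrite HardyE nE.
(* Only [P] and [M] are cancelled; the integrals of [LA] and [LB] may be infinite. *)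
have Mf : M \is a fin_num by exact: int_fin.
have Pf : P \is a fin_num by exact: int_fin.
rewrite -(fineK Mf) -(fineK Pf) -!EFinM in I1 *.
by rewrite mulrBr; exact: (addeEFin_inj _ _ _ _ _ I1).
Qed.

End same_sign.
End ground_state_identities.

(** * The identity for opposite signs *)

Section opposite_sign.
Context {R : realType}.
Local Notation mu := (@lebesgue_measure R).
Local Notation pos := (`]0%R, +oo[%classic : set R).

Lemma integral_powR0 (f : R -> \bar R) :
  \int[mu]_(t in pos) f t = \int[mu]_(t in pos) ((t `^ 0)%:E * f t).
Proof. by apply: eq_integral => t _; rewrite powRr0 mul1e. Qed.

Lemma half_line_norm_measurable (alpha : R) (v : R -> R) : measurable_fun setT v ->
  measurable_fun pos (fun x : R => (v x ^+ 2 * x `^ (- alpha))%:E).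
Proof.
move=> mv; apply: measurable_funTS; apply/measurable_EFinP; apply: measurable_funM.
  exact: measurable_funX.
exact: measurable_powR.
Qed.

(** The square terms of the pointwise identity: s = rho gives a^2 h(y)/h(x) up to a constant, and s
    = 0 gives a^2. *)
Definition radial_form (s : R) (kap : R -> R -> \bar R) (v : R -> R) x y : \bar R :=
  (v x ^+ 2 * (y `^ s * x `^ (- s)))%:E * kap x y.

Lemma radial_form_measurable (s : R) (kap : R -> R -> \bar R) (v : R -> R) :
  jointly_measurable kap -> measurable_fun setT v ->
  jointly_measurable (radial_form s kap v).
Proof.
move=> mkap mv; apply: (jointly_measurable_weight _ mkap
  (fun x y => v x ^+ 2 * (y `^ s * x `^ (- s)))%R).
apply: measurable_funM.
  by apply: measurable_funX; exact: measurable_fst_comp.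
apply: measurable_funM.
  by apply: (measurable_snd_comp (fun y : R => y `^ s)%R); exact: measurable_powR.
by apply: (measurable_fst_comp (fun x : R => x `^ (- s))%R); exact: measurable_powR.
Qed.

Lemma radial_form_ge0 (s : R) (kap : R -> R -> \bar R) (v : R -> R) x y :
  (forall x y, 0 <= kap x y) -> 0 <= radial_form s kap v x y.
Proof.
by move=> kap0; rewrite mule_ge0// lee_fin mulr_ge0 ?sqr_ge0// mulr_ge0 ?powR_ge0.
Qed.

(** With y = x t the ratio y^s x^(-s) is t^s, so the variables separate. *)
Lemma radial_integral (alpha s : R) (kap : R -> R -> \bar R) (v : R -> R) :
  jointly_measurable kap -> (forall x y, 0 <= kap x y) ->
  (forall x y t, (0 < t)%R ->
    kap (t * x)%R (t * y)%R = (t `^ (- alpha - 1))%:E * kap x y) ->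
  measurable_fun setT v ->
  \int[mu]_(x in pos) \int[mu]_(y in pos) radial_form s kap v x y =
  half_line_norm alpha v * \int[mu]_(t in pos) ((t `^ s)%:E * kap 1%R t).
Proof.
move=> mkap kap0 homkap mv.
have mtk : measurable_fun pos (fun t : R => (t `^ s)%:E * kap 1%R t).
  apply: measurable_funTS; apply: emeasurable_funM; last exact: jointly_measurable1.
  by apply/measurable_EFinP; exact: measurable_powR.
have tk0 (t : R) : 0 <= (t `^ s)%:E * kap 1%R t by rewrite mule_ge0// lee_fin powR_ge0.
have vv0 (x : R) : (0 <= v x ^+ 2 * x `^ (- alpha))%R by rewrite mulr_ge0 ?sqr_ge0 ?powR_ge0.
rewrite integral_quadrant_polar; last 2 first.
- exact: radial_form_measurable.
- by move=> x y; exact: radial_form_ge0.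
rewrite /half_line_norm -ge0_integralZr//; last 3 first.
- exact: half_line_norm_measurable.
- by move=> x _; rewrite lee_fin.
- by apply: integral_ge0 => t _.
apply: eq_integral => x; rewrite inE/= in_itv/= andbT => x0.
rewrite -ge0_integralZl_EFin//; apply: eq_integral => t; rewrite inE/= in_itv/= andbT => t0.
rewrite /radial_form (homogeneous_kernel_polar alpha)// muleA -EFinM; congr (_%:E * _).
rewrite powRM ?ltW//.
have : (x `^ s * x `^ (- s) = 1)%R by rewrite -powR_gt0D// subrr powRr0.
move: (x `^ s)%R (x `^ (- s))%R => p q pq.
by transitivity (v x ^+ 2 * x `^ (- alpha) * t `^ s * (p * q))%R; [ring|rewrite pq mulr1].
Qed.

Lemma ge0_integral_plane_add (F G : R -> R -> \bar R) :
  jointly_measurable F -> jointly_measurable G ->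
  (forall x y, 0 <= F x y) -> (forall x y, 0 <= G x y) ->
  \int[mu]_(x in pos) \int[mu]_(y in pos) (F x y + G x y) =
  \int[mu]_(x in pos) \int[mu]_(y in pos) F x y +
  \int[mu]_(x in pos) \int[mu]_(y in pos) G x y.
Proof.
move=> mF mG F0 G0.
rewrite -[RHS]ge0_integralD//; last 4 first.
- by move=> x _; exact: integral_ge0.
- by apply: measurable_funTS; exact: measurable_int_in.
- by move=> x _; exact: integral_ge0.
- by apply: measurable_funTS; exact: measurable_int_in.
apply: eq_integral => x _; rewrite ge0_integralD//.
- by apply: measurable_funTS; exact: jointly_measurable1.
- by apply: measurable_funTS; exact: jointly_measurable1.
Qed.

Lemma opposite_sign_identity (alpha rho r : R) (kap : R -> R -> \bar R) (v w : R -> R) :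
  jointly_measurable kap -> (forall x y, 0 <= kap x y) ->
  (forall x y t, (0 < t)%R ->
    kap (t * x)%R (t * y)%R = (t `^ (- alpha - 1))%:E * kap x y) ->
  measurable_fun setT v -> measurable_fun setT w -> (0 < r)%R ->
  \int[mu]_(x in pos) \int[mu]_(y in pos) difference_form kap v w x y +
  (half_line_norm alpha v * (r%:E * \int[mu]_(t in pos) ((t `^ rho)%:E * kap 1%R t)) +
   half_line_norm alpha w * (r^-1%:E * \int[mu]_(t in pos) ((t `^ rho)%:E * kap t 1%R))) =
  \int[mu]_(x in pos) \int[mu]_(y in pos) ground_state_form rho kap 1 r v w x y +
  (half_line_norm alpha v * \int[mu]_(t in pos) kap 1%R t +
   half_line_norm alpha w * \int[mu]_(t in pos) kap t 1%R).
Proof.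
move=> mkap kap0 homkap mv mw r0.
(* The square terms in [w] are radial in [y]; transposing the kernel brings them under
   [radial_integral], and Tonelli restores the order. *)
pose kapT x y := kap y x.
have mkapT : jointly_measurable kapT by exact: jointly_measurable_swap.
have kapT0 x y : 0 <= kapT x y by exact: kap0.
have homT x y t : (0 < t)%R -> kapT (t * x)%R (t * y)%R = (t `^ (- alpha - 1))%:E * kapT x y.
  exact: homkap.
pose I2 (F : R -> R -> \bar R) := \int[mu]_(x in pos) \int[mu]_(y in pos) F x y.
pose good (F : R -> R -> \bar R) := jointly_measurable F /\ forall x y, 0 <= F x y.
have eqI F G : (forall x y, (0 < x)%R -> (0 < y)%R -> F x y = G x y) -> I2 F = I2 G.
  move=> FG; apply: eq_integral => x; rewrite inE/= in_itv/= andbT => x0.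
  by apply: eq_integral => y; rewrite inE/= in_itv/= andbT => y0; exact: FG.
have addI F G : good F -> good G -> I2 F + I2 G = I2 (fun x y => F x y + G x y).
  by move=> [mF F0] [mG G0]; rewrite -ge0_integral_plane_add.
have goodD F G : good F -> good G -> good (fun x y => F x y + G x y).
  move=> [mF F0] [mG G0]; split; first exact: emeasurable_funD.
  by move=> x y; rewrite adde_ge0.
have scaleI (c : R) F : (0 < c)%R -> good F -> c%:E * I2 F = I2 (fun x y => c%:E * F x y).
  move=> c0 [mF F0]; rewrite -[LHS]ge0_integralZl_EFin//; last 3 first.
  - by move=> x _; exact: integral_ge0.
  - by apply: measurable_funTS; exact: measurable_int_in.
  - exact: ltW.
  apply: eq_integral => x _; rewrite -ge0_integralZl_EFin//; last exact: ltW.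
  by apply: measurable_funTS; exact: jointly_measurable1.
have goodZ (c : R) F : (0 < c)%R -> good F -> good (fun x y => c%:E * F x y).
  move=> c0 [mF F0]; split; first exact: measurable_funeM.
  by move=> x y; rewrite mule_ge0// lee_fin ltW.
have radI s : half_line_norm alpha v * \int[mu]_(t in pos) ((t `^ s)%:E * kap 1%R t) =
    I2 (radial_form s kap v) by rewrite -(radial_integral _ _ _ _ mkap kap0 homkap mv).
have radIT s : half_line_norm alpha w * \int[mu]_(t in pos) ((t `^ s)%:E * kap t 1%R) =
    I2 (fun x y => radial_form s kapT w y x).
  rewrite -[LHS](radial_integral _ _ _ _ mkapT kapT0 homT mw) /I2.
  apply: (tonelli_in pos pos (radial_form s kapT w)).
  - exact: measurable_itv.
  - exact: measurable_itv.
  - exact: (radial_form_measurable _ _ _ mkapT mw).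
  - by move=> x y _ _; exact: radial_form_ge0.
have goodR s : good (radial_form s kap v).
  by split; [exact: radial_form_measurable|move=> x y; exact: radial_form_ge0].
have goodRT s : good (fun x y => radial_form s kapT w y x).
  split; last by move=> x y; exact: radial_form_ge0.
  exact: (jointly_measurable_swap (radial_form s kapT w) (radial_form_measurable _ _ _ mkapT mw)).
have goodF : good (difference_form kap v w).
  by split; [exact: difference_form_measurable|move=> x y; exact: difference_form_ge0].
have goodG : good (ground_state_form rho kap 1 r v w).
  by split; [exact: ground_state_form_measurable|move=> x y; exact: ground_state_form_ge0].
have r'0 : (0 < r^-1)%R by rewrite invr_gt0.
have T1 : half_line_norm alpha v * (r%:E * \int[mu]_(t in pos) ((t `^ rho)%:E * kap 1%R t)) =
    I2 (fun x y => r%:E * radial_form rho kap v x y).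
  apply: (etrans (muleCA _ _ _)); apply: (etrans (congr1 _ (radI rho))).
  exact: (scaleI _ _ r0 (goodR rho)).
have T2 : half_line_norm alpha w * (r^-1%:E * \int[mu]_(t in pos) ((t `^ rho)%:E * kap t 1%R)) =
    I2 (fun x y => r^-1%:E * radial_form rho kapT w y x).
  apply: (etrans (muleCA _ _ _)); apply: (etrans (congr1 _ (radIT rho))).
  exact: (scaleI _ _ r'0 (goodRT rho)).
have T3 : half_line_norm alpha v * \int[mu]_(t in pos) kap 1%R t =
    I2 (radial_form 0 kap v) by exact: (etrans (congr1 _ (integral_powR0 _)) (radI 0%R)).
have T4 : half_line_norm alpha w * \int[mu]_(t in pos) kap t 1%R =
    I2 (fun x y => radial_form 0 kapT w y x).
  exact: (etrans (congr1 _ (integral_powR0 (kap ^~ 1%R))) (radIT 0%R)).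
apply: (etrans (congr1 _ (congr2 _ T1 T2))); apply: (etrans _ (esym (congr1 _ (congr2 _ T3 T4)))).
rewrite -/(I2 (difference_form kap v w)) -/(I2 (ground_state_form rho kap 1 r v w)).
(* From here on only the additivity of [I2] and its dependence on positive arguments matter, so its
   body is forgotten. *)
move: I2 eqI addI {scaleI radI radIT T1 T2 T3 T4} => I2 eqI addI.
have gT1 := goodZ _ _ r0 (goodR rho); have gT2 := goodZ _ _ r'0 (goodRT rho).
rewrite (addI _ _ gT1 gT2) (addI _ _ goodF (goodD _ _ gT1 gT2)).
rewrite (addI _ _ (goodR 0%R) (goodRT 0%R)) (addI _ _ goodG (goodD _ _ (goodR 0%R) (goodRT 0%R))).
apply: eqI => x y x0 y0.
rewrite /difference_form /ground_state_form /radial_form /kapT !muleA -!EFinM.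
(* The kernel value may be [+oo], so factoring it out of the sums rests on the nonnegativity of
   every coefficient. *)
have h0 c z : (0 < c)%R -> (0 <= c * z `^ rho)%R.
  by move=> c0; rewrite mulr_ge0 ?powR_ge0// ltW.
have q0 s (a b c : R) : (0 <= a ^+ 2 * (b `^ s * c `^ (- s)))%R.
  by rewrite mulr_ge0 ?sqr_ge0// mulr_ge0 ?powR_ge0.
have t1 : (0 <= r * (v x ^+ 2 * (y `^ rho * x `^ (- rho))))%R by rewrite mulr_ge0// ltW.
have t2 : (0 <= r^-1 * (w y ^+ 2 * (x `^ rho * y `^ (- rho))))%R by rewrite mulr_ge0// ltW.
have t3 : (0 <= (v x / (1 * x `^ rho) - w y / (r * y `^ rho)) ^+ 2
    * (1 * x `^ rho) * (r * y `^ rho))%R.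
  by rewrite mulr_ge0 ?h0// mulr_ge0 ?h0// sqr_ge0.
rewrite -!ge0_muleDl ?lee_fin ?addr_ge0 ?sqr_ge0//.
congr (_ * _); rewrite -!EFinD; congr (_%:E).
rewrite oppr0 !powRr0 !powRN.
have X0 := powR_gt0 rho x0; have Y0 := powR_gt0 rho y0.
move: (x `^ rho)%R (y `^ rho)%R X0 Y0 => X Y X0 Y0.
by field; rewrite !gt_eqF.
Qed.

End opposite_sign.

(** * Assembling the identities *)

Section hardy_identity.
Context {R : realType}.
Local Notation mu := (@lebesgue_measure R).
Local Notation pos := (`]0%R, +oo[%classic : set R).
Local Notation I01 := (`]0%R, 1%R[%classic : set R).

Lemma measurable_opp_comp d (T : measurableType d) (p : T -> R) :
  measurable_fun setT p -> measurable_fun setT (fun z => - p z)%R.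
Proof. by move=> mp; exact: measurable_funN. Qed.

(** Symmetry makes each of the three regions occur twice, and the factor 1/2 removes the repetition,
    infinite values included. *)
Lemma half_plane_integral (F : R -> R -> \bar R) : jointly_measurable F ->
  (forall x y, 0 <= F x y) -> (forall x y, F x y = F y x) ->
  2^-1%:E * \int[mu]_x \int[mu]_y F x y =
  \int[mu]_(t in I01) \int[mu]_(x in pos) (x%:E * F x (x * t)%R) +
  (\int[mu]_(t in I01) \int[mu]_(x in pos) (x%:E * F (- x)%R (- (x * t))%R) +
   \int[mu]_(x in pos) \int[mu]_(y in pos) F x (- y)%R).
Proof.
move=> mF F0 Fsym.
have mNN : jointly_measurable (fun x y => F (- x)%R (- y)%R).
  by apply: (jointly_measurable_comp _ _ F (fun z : R * R => - z.1)%R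
    (fun z : R * R => - z.2)%R) => //;
    exact: measurable_opp_comp.
rewrite -(integral_triangle_polar F)// -(integral_triangle_polar (fun x y => F (- x)%R (- y)%R))//.
rewrite integral_quadrants//.
rewrite (integral_triangle F)// (integral_triangle (fun x y => F (- x)%R (- y)%R))//.
have pos0 (f : R -> \bar R) : (forall x, 0 <= f x) -> 0 <= \int[mu]_(x in pos) f x.
  by move=> f0; exact: integral_ge0.
have A0 : 0 <= \int[mu]_(x in pos) \int[mu]_(y in `]0%R, x[) F x y.
  by apply: (pos0) => x; exact: integral_ge0.
have B0 : 0 <= \int[mu]_(x in pos) \int[mu]_(y in `]0%R, x[) F (- x)%R (- y)%R.
  by apply: (pos0) => x; exact: integral_ge0.
have C0 : 0 <= \int[mu]_(x in pos) \int[mu]_(y in pos) F x (- y)%R.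
  by apply: (pos0) => x; exact: pos0.
move: A0 B0 C0; move: (\int[mu]_(x in pos) _) (\int[mu]_(x in pos) _) (\int[mu]_(x in pos) _).
move=> A B C A0 B0 C0.
have half (z : \bar R) : 0 <= z -> 2^-1%:E * (z + z) = z.
  move=> z0; rewrite ge0_muleDr// -ge0_muleDl// -EFinD -[RHS]mul1e; congr (_%:E * _).
  by field.
by rewrite [X in _ * (X + _)]addeACA [X in _ * X]addeACA half ?adde_ge0// addeA.
Qed.

Lemma half_line_norm_split (alpha : R) (u : R -> R) : measurable_fun setT u ->
  \int[mu]_x (u x ^+ 2 * `|x| `^ (- alpha))%:E =
  half_line_norm alpha u + half_line_norm alpha (fun x => u (- x)%R).
Proof.
move=> mu_.
have mf : measurable_fun setT (fun x : R => (u x ^+ 2 * `|x| `^ (- alpha))%:E).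
  apply/measurable_EFinP; apply: measurable_funM; first exact: measurable_funX.
  by apply: measurable_powR_comp; exact: normr_measurable.
rewrite (ge0_integral_pos_opp _ mf); last first.
  by move=> x; rewrite lee_fin mulr_ge0 ?sqr_ge0 ?powR_ge0.
apply: congr2.
  rewrite /half_line_norm; apply: eq_integral => x.
  by rewrite inE/= in_itv/= andbT => x0; rewrite gtr0_norm.
rewrite /half_line_norm; apply: eq_integral => x.
by rewrite inE/= in_itv/= andbT => x0; rewrite normrN gtr0_norm.
Qed.

(** Since [a] and [b] may be negative, they are pulled out by linearity for integrable functions;
    the finite half-line norms supply integrability. *)
Lemma hardy_potential_integral (alpha rho r a b : R) (k : R -> R -> \bar R) (u : R -> R) :
  measurable_fun setT u ->
  C_plus alpha k r rho = a%:E -> C_minus alpha k r rho = b%:E ->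
  half_line_norm alpha u < +oo -> half_line_norm alpha (fun x => u (- x)%R) < +oo ->
  \int[mu]_x ((u x ^+ 2)%:E * hardy_potential alpha k r rho x) =
  a%:E * half_line_norm alpha u + b%:E * half_line_norm alpha (fun x => u (- x)%R).
Proof.
move=> mu_ Ca Cb up um.
pose W (x : R) : R := (u x ^+ 2 * `|x| `^ (- alpha))%R.
have W0 x : (0 <= W x)%R by rewrite mulr_ge0 ?sqr_ge0 ?powR_ge0.
have mW : measurable_fun setT (fun x => (W x)%:E).
  apply/measurable_EFinP; apply: measurable_funM; first exact: measurable_funX.
  by apply: measurable_powR_comp; exact: normr_measurable.
pose q (x : R) : R := (if 0 < x then a else if x < 0 then b else 0)%R.
have mq : measurable_fun setT q.
  apply: measurable_fun_ifT => //; first exact: measurable_fun_ltr.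
  by apply: measurable_fun_ifT => //; exact: measurable_fun_ltr.
have fE x : (u x ^+ 2)%:E * hardy_potential alpha k r rho x = (q x)%:E * (W x)%:E.
  rewrite /hardy_potential /q Ca Cb; case: ifP => _; last case: ifP => _.
  - by rewrite -!EFinM /W; congr (_%:E); ring.
  - by rewrite -!EFinM /W; congr (_%:E); ring.
  - by rewrite mule0 mul0e.
under eq_integral do rewrite fE.
have mqW : measurable_fun setT (fun x => (q x)%:E * (W x)%:E).
  by apply: emeasurable_funM => //; exact/measurable_EFinP.
rewrite (integral_pos_neg _ mqW).
have Np : \int[mu]_(x in pos) (W x)%:E = half_line_norm alpha u.
  rewrite /half_line_norm; apply: eq_integral => x; rewrite inE/= in_itv/= andbT => x0.
  by rewrite /W gtr0_norm.
have Nm : \int[mu]_(x in `]-oo, 0%R[) (W x)%:E = half_line_norm alpha (fun x => u (- x)%R).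
  rewrite (integral_posN _ mW); last by move=> x; rewrite lee_fin.
  rewrite /half_line_norm; apply: eq_integral => x; rewrite inE/= in_itv/= andbT => x0.
  by rewrite /W normrN gtr0_norm.
have int D : measurable D -> \int[mu]_(x in D) (W x)%:E < +oo ->
    mu.-integrable D (fun x => (W x)%:E).
  move=> mD Wy; apply/integrableP; split; first exact: measurable_funTS.
  apply: le_lt_trans Wy; rewrite le_eqVlt; apply/orP; left; apply/eqP.
  by apply: eq_integral => x _; apply: gee0_abs; rewrite lee_fin.
have Ip := int pos (measurable_itv _); rewrite Np in Ip.
have Im := int _ (measurable_itv `]-oo, 0%R[); rewrite Nm in Im.
apply: congr2.
- rewrite -Np -(integralZl _ (Ip up)); last exact: measurable_itv.
  by apply: eq_integral => x; rewrite inE/= in_itv/= andbT => x0; rewrite /q x0.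
- rewrite -Nm -(integralZl _ (Im um)); last exact: measurable_itv.
  apply: eq_integral => x; rewrite inE/= in_itv/= => x0.
  by rewrite /q x0 ltNge (ltW x0).
Qed.

Lemma kernel_moment_fin_num (alpha s c : R) (f : R -> \bar R) : (-1 < s < alpha)%R ->
  (0 <= c)%R -> measurable_fun setT f -> (forall t, 0 <= f t) ->
  (forall t, (0 < t)%R -> f t <= (c * (1 + t) `^ (- alpha - 1))%:E) ->
  \int[mu]_(t in pos) ((t `^ s)%:E * f t) \is a fin_num.
Proof.
move=> sa c0 mf f0 fle.
have ms : measurable_fun setT (fun t : R => t `^ s)%R by exact: measurable_powR.
have m1 : measurable_fun setT (fun t : R => (1 + t) `^ (- alpha - 1))%R.
  by apply: measurable_powR_comp; exact: measurable_funD.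
have mw : measurable_fun pos (fun t : R => (t `^ s * (1 + t) `^ (- alpha - 1))%:E).
  by apply: measurable_funTS; apply/measurable_EFinP; exact: measurable_funM.
rewrite ge0_fin_numE; last first.
  by apply: integral_ge0 => t _; rewrite mule_ge0// lee_fin powR_ge0.
apply: (@le_lt_trans _ _ (\int[mu]_(t in pos) (c%:E * (t `^ s * (1 + t) `^ (- alpha - 1))%:E))).
  apply: ge0_le_integral => //.
  - by move=> t _; rewrite mule_ge0// lee_fin powR_ge0.
  - by apply: measurable_funTS; apply: emeasurable_funM => //; exact/measurable_EFinP.
  - exact: measurable_funeM.
  move=> t /=; rewrite in_itv/= andbT => t0; rewrite -EFinM mulrCA EFinM.
  by apply: lee_wpmul2l; [rewrite lee_fin powR_ge0|exact: fle].
rewrite ge0_integralZl_EFin//; last first.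
  by move=> t _; rewrite lee_fin mulr_ge0 ?powR_ge0.
apply: lte_mul_pinfty; [by rewrite lee_fin|by []|].
exact: integral_powR_1D_lty.
Qed.

End hardy_identity.

(** * Reduction of both double integrals to the positive half-line *)

Section sign_decomposition.
Context {R : realType}.
Local Notation mu := (@lebesgue_measure R).
Local Notation pos := (`]0%R, +oo[%classic : set R).
Local Notation I01 := (`]0%R, 1%R[%classic : set R).
Variables (k : R -> R -> \bar R) (u : R -> R) (rho r : R).
Hypotheses (mk : jointly_measurable k) (k0 : forall x y, 0 <= k x y).
Hypotheses (ksym : forall x y, k x y = k y x) (mu_ : measurable_fun setT u).
Hypothesis r0 : (0 < r)%R.

Let uN (x : R) := u (- x)%R.
Let kNN (x y : R) := k (- x)%R (- y)%R.
Let kPN (x y : R) := k x (- y)%R.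

Lemma energy_sign_decomposition : energy k u =
  \int[mu]_(t in I01) \int[mu]_(x in pos) (x%:E * difference_form k u u x (x * t)%R) +
  (\int[mu]_(t in I01) \int[mu]_(x in pos)
     (x%:E * difference_form kNN uN uN x (x * t)%R) +
   \int[mu]_(x in pos) \int[mu]_(y in pos) difference_form kPN u uN x y).
Proof.
apply: (half_plane_integral (difference_form k u u)).
- exact: difference_form_measurable.
- exact: difference_form_ge0.
- by move=> x y; rewrite /difference_form ksym -sqrrN opprB.
Qed.

Let h := ground_state rho r.

Let hE x : (0 < x)%R -> h x = (1 * x `^ rho)%R.
Proof. by move=> x0; rewrite /h /ground_state x0 gtr0_norm// mul1r. Qed.

Let hNE x : (0 < x)%R -> h (- x)%R = (r * x `^ rho)%R.
Proof.
move=> x0; rewrite /h /ground_state oppr_gt0 oppr_lt0 x0 ltNge ltW//=.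
by rewrite normrN gtr0_norm.
Qed.

Let h_ge0 x : (0 <= h x)%R.
Proof.
rewrite /h /ground_state; case: ifP => _; first exact: powR_ge0.
by case: ifP => _ //; rewrite mulr_ge0 ?powR_ge0// ltW.
Qed.

Let measurable_sign_if (f g : R -> R) : measurable_fun setT f -> measurable_fun setT g ->
  measurable_fun setT (fun x : R => if 0 < x then f x else if x < 0 then g x else 0)%R.
Proof.
move=> mf mg; apply: measurable_fun_ifT => //; first exact: measurable_fun_ltr.
by apply: measurable_fun_ifT => //; exact: measurable_fun_ltr.
Qed.

Let measurable_norm_powR p : measurable_fun setT (fun x : R => `|x| `^ p)%R.
Proof. by apply: measurable_powR_comp; exact: normr_measurable. Qed.

Let measurable_h : measurable_fun setT h.
Proof. by apply: measurable_sign_if => //; exact: measurable_funM. Qed.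

Let measurable_hV : measurable_fun setT (fun x : R => (h x)^-1)%R.
Proof.
(* The inverse has the same piecewise shape with exponent -rho; at 0 the convention that 0 has
   inverse 0 keeps the formula valid. *)
rewrite (_ : (fun x => _) = (fun x : R => if 0 < x then `|x| `^ (- rho)
    else if x < 0 then r^-1 * `|x| `^ (- rho) else 0)%R).
  by apply: measurable_sign_if => //; exact: measurable_funM.
apply/funext => x; rewrite /h /ground_state powRN; case: ifP => // _.
by case: ifP => _; rewrite ?invr0// invfM.
Qed.

Let G x y := ((u x / h x - u y / h y) ^+ 2 * h x * h y)%:E * k x y.

Let measurable_G : jointly_measurable G.
Proof.
apply: (jointly_measurable_weight _ mk
  (fun x y => (u x / h x - u y / h y) ^+ 2 * h x * h y)%R).
have muh : measurable_fun setT (fun x : R => u x / h x)%R by exact: measurable_funM.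
apply: measurable_funM; first apply: measurable_funM.
- apply: measurable_funX; apply: measurable_funB.
    exact: (measurable_fst_comp (fun x => u x / h x)%R).
  exact: (measurable_snd_comp (fun x => u x / h x)%R).
- exact: measurable_fst_comp.
- exact: measurable_snd_comp.
Qed.

Let G_sym x y : G x y = G y x.
Proof.
by rewrite /G ksym -[((u y / _ - _) ^+ 2)%R]sqrrN opprB -!mulrA (mulrC (h x)).
Qed.

Lemma ground_state_sign_decomposition :
  2^-1%:E * \int[mu]_y \int[mu]_x G x y =
  \int[mu]_(t in I01) \int[mu]_(x in pos)
    (x%:E * ground_state_form rho k 1 1 u u x (x * t)%R) +
  (\int[mu]_(t in I01) \int[mu]_(x in pos)
     (x%:E * ground_state_form rho kNN r r uN uN x (x * t)%R) +
   \int[mu]_(x in pos) \int[mu]_(y in pos) ground_state_form rho kPN 1 r u uN x y).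
Proof.
(* After renaming the bound variables this is the symmetry of [G]. *)
have -> : \int[mu]_y \int[mu]_x G x y = \int[mu]_x \int[mu]_y G x y.
  by apply: eq_integral => y _; apply: eq_integral => x _; exact: G_sym.
apply: (etrans (half_plane_integral G measurable_G _ G_sym)).
  by move=> x y; rewrite mule_ge0// lee_fin mulr_ge0// mulr_ge0// sqr_ge0.
apply: congr2; last apply: congr2.
- apply: eq_integral => t; rewrite inE/= in_itv/= => /andP[t0 _].
  apply: eq_integral => x; rewrite inE/= in_itv/= andbT => x0.
  by rewrite /G /ground_state_form !hE// mulr_gt0.
- apply: eq_integral => t; rewrite inE/= in_itv/= => /andP[t0 _].
  apply: eq_integral => x; rewrite inE/= in_itv/= andbT => x0.
  by rewrite /G /ground_state_form !hNE// mulr_gt0.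
- apply: eq_integral => x; rewrite inE/= in_itv/= andbT => x0.
  apply: eq_integral => y; rewrite inE/= in_itv/= andbT => y0.
  by rewrite /G /ground_state_form hE// hNE.
Qed.

End sign_decomposition.

(** Pure algebra in the extended reals: norms, Hardy constants and kernel moments are real, while
    energies and ground-state forms may be infinite. *)
Lemma combine_sign_identities (R : realType) (n1 n2 g1 g2 i1 i2 p1 p2 r s : R)
    (e H q T T' X TG TG' XG : \bar R) :
  T = TG + n1%:E * g1%:E -> T' = TG' + n2%:E * g2%:E ->
  X + (n1%:E * (r%:E * p1%:E) + n2%:E * (s%:E * p2%:E)) =
    XG + (n1%:E * i1%:E + n2%:E * i2%:E) ->
  e = T + (T' + X) -> q = TG + (TG' + XG) ->
  H = (g1 + i1 - r * p1)%:E * n1%:E + (g2 + i2 - s * p2)%:E * n2%:E -> e = H + q.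
Proof.
rewrite -!EFinM -!EFinD => -> -> /addeEFin_inj -> -> -> ->.
rewrite (addeC _%:E) addeACA -!addeA; congr (_ + (_ + _)).
by rewrite addeA -EFinD addeCA -EFinD; congr (_ + _%:E); ring.
Qed.

Theorem corollary3p9 (R : realType) (alpha rho r : R)
    (k : R -> R -> \bar R) (u : R -> R)
    (halpha : (0 < alpha < 2)%R) (hrho : (-1 < rho < alpha)%R)
    (hr : (0 < r)%R) (hk : k \in homogeneous_kernels alpha)
    (hu : u \in weighted_L2 alpha) :
  energy k u =
    \int[@lebesgue_measure R]_x
      ((u x ^+ 2)%:E * hardy_potential alpha k r rho x)
    + 2^-1%:E *
      \int[@lebesgue_measure R]_y \int[@lebesgue_measure R]_x
        (((u x / ground_state rho r x - u y / ground_state rho r y) ^+ 2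
          * ground_state rho r x * ground_state rho r y)%:E * k x y).
Proof.
move: hk hu; rewrite !inE => -[mk k0 ksym khom [c c0 kle]] [mu uL2].
pose uN (x : R) := u (- x)%R.
pose kNN x y := k (- x)%R (- y)%R.
pose kPN x y := k x (- y)%R.
have muN : measurable_fun setT uN by apply: (measurableT_comp mu); exact: oppr_measurable.
have mN1 : measurable_fun [set: R * R] (fun z => - z.1)%R by exact: measurable_opp_comp.
have mN2 : measurable_fun [set: R * R] (fun z => - z.2)%R by exact: measurable_opp_comp.
have mkNN : jointly_measurable kNN by exact: (jointly_measurable_comp _ _ k _ _ mk mN1 mN2).
have mkPN : jointly_measurable kPN.
  exact: (jointly_measurable_comp _ _ k _ _ mk measurable_fst mN2).
have kNN0 x y : 0 <= kNN x y by exact: k0.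
have kPN0 x y : 0 <= kPN x y by exact: k0.
have kNNhom x y t : (0 < t)%R ->
    kNN (t * x)%R (t * y)%R = (t `^ (- alpha - 1))%:E * kNN x y.
  by move=> t0; rewrite /kNN -!mulrN khom.
have kPNhom x y t : (0 < t)%R ->
    kPN (t * x)%R (t * y)%R = (t `^ (- alpha - 1))%:E * kPN x y.
  by move=> t0; rewrite /kPN -!mulrN khom.
have c0' := ltW c0.
have k_le t : (0 < t < 1)%R -> k 1%R t <= (c * (1 - t) `^ (- alpha - 1))%:E.
  move=> /andP[t0 t1]; have := kle 1%R t.
  by rewrite gt_eqF// gtr0_norm ?subr_gt0//; apply.
have kNN_le t : (0 < t < 1)%R -> kNN 1%R t <= (c * (1 - t) `^ (- alpha - 1))%:E.
  move=> /andP[t0 t1]; have := kle (- 1)%R (- t)%R.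
  rewrite eqr_opp gt_eqF// opprK addrC distrC gtr0_norm ?subr_gt0//; exact.
have kPN_le t : (0 < t)%R -> kPN 1%R t <= (c * (1 + t) `^ (- alpha - 1))%:E.
  move=> t0; have := kle 1%R (- t)%R.
  by rewrite gt_eqF ?(lt_trans _ ltr01) ?oppr_lt0// opprK gtr0_norm ?addr_gt0//; apply.
have kPN_leT t : (0 < t)%R -> kPN t 1%R <= (c * (1 + t) `^ (- alpha - 1))%:E.
  move=> t0; have := kle t (- 1)%R.
  by rewrite gt_eqF ?(lt_trans _ t0) ?oppr_lt0// opprK addrC gtr0_norm ?addr_gt0//; apply.
have := uL2; rewrite half_line_norm_split// -/uN => NN.
have Np : half_line_norm alpha u < +oo.
  by apply: le_lt_trans NN; rewrite leeDl ?half_line_norm_ge0.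
have Nm : half_line_norm alpha uN < +oo.
  by apply: le_lt_trans NN; rewrite leeDr ?half_line_norm_ge0.
have E := energy_sign_decomposition _ _ mk k0 ksym mu.
have Q := ground_state_sign_decomposition _ _ rho _ mk k0 ksym mu hr.
(* The ground state has constant 1 on the positive half-line and [r] on the negative one. *)
have S1 := same_sign_identity _ _ _ mk k0 khom _ _ halpha hrho mu c0' k_le Np _ ltr01.
have S2 := same_sign_identity _ _ _ mkNN kNN0 kNNhom _ _ halpha hrho muN c0' kNN_le Nm _ hr.
have S3 := opposite_sign_identity _ rho _ _ _ _ mkPN kPN0 kPNhom mu muN hr.
(* Symmetry turns k(t, -1) into the k(-1, t) of [C_minus]. *)
have kPNE : (fun t => kPN t 1%R) = k (-1)%R by apply/funext => t; rewrite /kPN ksym.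
have fin_exists (z : \bar R) : z \is a fin_num -> exists x : R, z = x%:E.
  by move=> zf; exists (fine z); rewrite fineK.
(* Naming every constant as a real makes [C_plus] and [C_minus] real, so that their signed terms can
   be moved freely. *)
have [g1 g1E] := fin_exists _ (Hardy_constant_fin_num _ _ _ mk k0 _ halpha hrho c0' k_le).
have [g2 g2E] := fin_exists _ (Hardy_constant_fin_num _ _ _ mkNN kNN0 _ halpha hrho c0' kNN_le).
have /andP[a0 a2] := halpha; have /andP[r1 ra] := hrho.
have I0a : (-1 < (0 : R) < alpha)%R by rewrite a0 andbT ltrN10.
have mX1 : measurable_fun setT (kPN 1%R) by exact: jointly_measurable1.
have mX2 : measurable_fun setT (fun t => kPN t 1%R).
  exact: (jointly_measurable1 _ _ (jointly_measurable_swap _ mkPN)).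
have [i1 i1E] := fin_exists _ (kernel_moment_fin_num _ _ _ _ I0a c0' mX1 (kPN0 1%R) kPN_le).
have [i2 i2E] := fin_exists _ (kernel_moment_fin_num _ _ _ _ I0a c0' mX2 (kPN0 ^~ 1%R) kPN_leT).
have [p1 p1E] := fin_exists _ (kernel_moment_fin_num _ _ _ _ hrho c0' mX1 (kPN0 1%R) kPN_le).
have [p2 p2E] := fin_exists _ (kernel_moment_fin_num _ _ _ _ hrho c0' mX2 (kPN0 ^~ 1%R) kPN_leT).
rewrite -(integral_powR0 (kPN 1%R)) in i1E; rewrite -(integral_powR0 (fun t => kPN t 1%R)) in i2E.
have [n1 n1E] : exists n : R, half_line_norm alpha u = n%:E.
  by apply: fin_exists; rewrite ge0_fin_numE// half_line_norm_ge0.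
have [n2 n2E] : exists n : R, half_line_norm alpha uN = n%:E.
  by apply: fin_exists; rewrite ge0_fin_numE// half_line_norm_ge0.
have Cp : C_plus alpha k r rho = (g1 + i1 - r * p1)%:E.
  rewrite /C_plus /gamma_plus EFinB EFinD EFinM.
  by apply: congr2; [apply: congr2|apply: congr1; apply: congr1].
have i2E' : \int[lebesgue_measure]_(t in `]0%R, +oo[) k (-1)%R t = i2%:E by rewrite -kPNE.
have p2E' : \int[lebesgue_measure]_(t in `]0%R, +oo[) ((t `^ rho)%:E * k (-1)%R t) = p2%:E.
  by rewrite -kPNE.
have Cm : C_minus alpha k r rho = (g2 + i2 - r^-1 * p2)%:E.
  rewrite /C_minus /gamma_minus EFinB EFinD EFinM.
  by apply: congr2; [apply: congr2|apply: congr1; apply: congr1].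
have HP := hardy_potential_integral _ rho _ _ _ _ _ mu Cp Cm Np Nm.
rewrite -/uN n1E n2E in HP.
rewrite n1E g1E in S1; rewrite n2E g2E in S2.
rewrite n1E n2E i1E i2E p1E p2E in S3.
exact: (combine_sign_identities _ _ _ _ _ _ _ _ _ _ _ _ _ _ _ _ _ _ _ _ S1 S2 S3 E Q HP).
Qed.
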